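(* Let $r>0$ and let $R$ be a rational function of degree $n$ having no poles on the circle $\gamma_r=\{z:|z|=r\}$. Let $\mu$ be the function associated with $R$ and $r$ as in the context. For $p>0$ let $m_p$ be the integer in $\mathbb N\cap[\tfrac p2,1+\tfrac p2)$. Then for $0<p<q\le\infty$ $$\|R\|_{L^q(\gamma_r)}\le\left(\frac{m_p\,\|\mu\|_{L^\infty(\gamma_r)}+1}{2\pi r}\right)^{\frac1p-\frac1q}\|R\|_{L^p(\gamma_r)}.\qquad(1)$$ Moreover, if no pole of $R$ belongs to the annulus $A_\delta=\{z:\delta r<|z|<\delta^{-1}r\}$, where $\delta\in(0,1)$, then for $0<p<q\le\infty$ $$\|R\|_{L^q(\gamma_r)}\le\left(\frac{1}{2\pi r}\right)^{\frac1p-\frac1q}\left(m_p\,n\cdot\frac{1+\delta}{1-\delta}+1\right)^{\frac1p-\frac1q}\|R\|_{L^p(\gamma_r)}.\qquad(2)$$ The inequalities (1) and (2) are sharp for $(q,p)=(\infty,2)$, i.e. in this case each of them becomes an equality for some rational function $R\not\equiv0$ satisfying the corresponding hypotheses.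
   Context: The degree of a rational function is the number of its poles in $\overline{\mathbb C}=\mathbb C\cup\{\infty\}$ counted with multiplicity. $\|R\|_{L^{p}(\gamma_r)}=\left(\int_{\gamma_r}|R(\zeta)|^p|d\zeta|\right)^{1/p}$ for $0<p<\infty$, $\|R\|_{L^\infty(\gamma_r)}=\max_{\gamma_r}|R|$, and $1/\infty=0$. Given $r>0$ and a rational function $R$ of degree $n$ without poles on $\gamma_r$, put $\mathcal R(z)=R(z)\cdot\overline{R(r^2/\overline z)}$. Let $z_1,\dots,z_\nu$ be the pairwise distinct poles of $\mathcal R$ in the disc $|z|<r$ and $n_k$ their multiplicities, where poles are counted without cancellation against zeros: the $z_k$ are the distinct points of $|z|<r$ such that $z_k$ or its reflection $z_k^*=r^2/\overline{z_k}$ (with $0^*=\infty$) is a pole of $R$, and $n_k$ is the multiplicity of $z_k$ as a pole of $R$ plus the multiplicity of $z_k^*$ as a pole of $R$ (multiplicity $0$ meaning not a pole). Thus $\sum_{k=1}^\nu n_k=n$. Set $$\mu(z)=\sum_{k=1}^{\nu}\frac{n_k(r^2-|z_k|^2)}{|z-z_k|^2}.$$ *)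

(* Defs.v *)
From mathcomp Require Import all_boot all_order all_algebra.
From mathcomp Require Import generic_quotient fraction complex.
From mathcomp Require Import all_classical all_reals all_analysis.

Set Implicit Arguments.
Unset Strict Implicit.
Unset Printing Implicit Defensive.

Import Order.TTheory GRing.Theory Num.Theory.

Local Open Scope classical_set_scope.
Local Open Scope ring_scope.
Local Open Scope complex_scope.

(* Real-valued modulus (the norm `|z| of R[i] takes its values in R[i]). *)
Definition cmod (R : realType) (z : R[i]) : R := ComplexField.Normc.normc z.

Section RationalFunction.
Variable R : realType.
Local Notation C := R[i].

(* The representative of f need not be in lowest terms. *)
Definition rat_num (f : {fraction {poly C}}) : {poly C} :=
  (repr f).1 %/ gcdp (repr f).1 (repr f).2.

Definition rat_den (f : {fraction {poly C}}) : {poly C} :=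
  (repr f).2 %/ gcdp (repr f).1 (repr f).2.

(* At a finite pole of f this is 0, since x / 0 = 0. *)
Definition rat_eval (f : {fraction {poly C}}) (z : C) : C :=
  (rat_num f).[z] / (rat_den f).[z].

(* Points of the Riemann sphere are options, None being infinity.
   The subtraction is truncated: f = P / Q in lowest terms has a pole at
   infinity iff deg P > deg Q, and its multiplicity is then deg P - deg Q. *)
Definition pole_mult (f : {fraction {poly C}}) (a : option C) : nat :=
  if a is Some z then mup z (rat_den f)
  else (size (rat_num f) - size (rat_den f))%N.

Definition is_pole (f : {fraction {poly C}}) (a : option C) : Prop :=
  (0 < pole_mult f a)%N.

Definition rat_degree (f : {fraction {poly C}}) : nat :=
  \sum_(a \in [set a | is_pole f a]) pole_mult f a.

Definition circle (r : R) : set C := [set z | cmod z = r].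

Definition annulus (r d : R) : set C :=
  [set z | d * r < cmod z < d^-1 * r].

Definition no_pole_in (f : {fraction {poly C}}) (A : set C) : Prop :=
  forall z, A z -> ~ is_pole f (Some z).

Definition reflect_circle (r : R) (z : C) : option C :=
  if z == 0 then None else Some ((r ^+ 2)%:C / z^*).

(* The multiplicities n_k of the poles of f(z) * conj (f (r^2 / conj z)),
   counted without cancellation against zeros. *)
Definition sym_mult (r : R) (f : {fraction {poly C}}) (z : C) : nat :=
  (pole_mult f (Some z) + pole_mult f (reflect_circle r z))%N.

Definition mu (r : R) (f : {fraction {poly C}}) (zeta : C) : R :=
  \sum_(z \in [set z | cmod z < r /\ (0 < sym_mult r f z)%N])
    (sym_mult r f z)%:R * (r ^+ 2 - cmod z ^+ 2) / cmod (zeta - z) ^+ 2.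

Definition circle_pt (r t : R) : C := (r * cos t) +i* (r * sin t).

(* L^p norm on the circle |z| = r with respect to arc length |dz| = r dt.
   The case -oo is a dummy value. *)
Definition circle_norm (r : R) (p : \bar R) (g : C -> R) : R :=
  match p with
  | s%:E => (\int[lebesgue_measure]_(t in `[0, 2 * pi])
               (`|g (circle_pt r t)| `^ s * r)) `^ s^-1
  | +oo%E => sup [set `|g z| | z in circle r]
  | -oo%E => 0
  end.

Definition rat_norm (r : R) (p : \bar R) (f : {fraction {poly C}}) : R :=
  circle_norm r p (fun z => cmod (rat_eval f z)).

(* For p > 0 exactly one natural number m, denoted m_p, satisfies this. *)
Definition is_half_exponent (p : R) (m : nat) : Prop :=
  p / 2 <= m%:R < 1 + p / 2.

(* 1/p - 1/q with 1/oo = 0 *)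
Definition exponent_gap (p : R) (q : \bar R) : R := p^-1 - fine (q^-1)%E.

Definition mu_bound (r p : R) (q : \bar R) (m : nat)
    (f : {fraction {poly C}}) : R :=
  ((m%:R * circle_norm r +oo%E (mu r f) + 1) / (2 * pi * r))
    `^ exponent_gap p q * rat_norm r p%:E f.

Definition annulus_bound (r d p : R) (q : \bar R) (m n : nat)
    (f : {fraction {poly C}}) : R :=
  (1 / (2 * pi * r)) `^ exponent_gap p q *
  (m%:R * n%:R * ((1 + d) / (1 - d)) + 1) `^ exponent_gap p q *
  rat_norm r p%:E f.

End RationalFunction.

(* Main.v *)
Require Import Defs.
From mathcomp Require Import all_boot all_order all_algebra.
From mathcomp Require Import generic_quotient fraction complex.
From mathcomp Require Import all_classical all_reals all_analysis.
From mathcomp Require Import measurable_realfun.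
From mathcomp Require Import ring lra.

(** For [p = 2] rotate to the unit circle and reflect the poles of [R] inside the
    circle to the outside; this does not change [|R|] on the circle, and writes it as
    [|P / D_B|] with [D_B = prod (1 - conj b z)], [b] running over the points [z_k / r]
    repeated [n_k] times, and [deg P <= n]. Splitting off the factors of [D_B] one at a
    time, [P / D_B] becomes an orthogonal sum of a constant and of multiples of the
    Takenaka-Malmquist functions [z N_B / D_(b :: B)], [N_B = prod (z - b)], whose
    squared moduli on the circle are the Poisson kernels up to normalisation.
    Cauchy-Schwarz then gives [|R|^2 <= (mu + 1) / (2 pi r) * norm_2(R)^2]. For general
    [p], apply this to [R^m] with [2 m >= p] and use
    [|R|^(2m) <= sup|R|^(2m-p) |R|^p] under the integral; [q < oo] follows by
    interpolation. Equality for [(oo, 2)] holds for a reproducing kernel. *)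

Set Implicit Arguments.
Unset Strict Implicit.
Unset Printing Implicit Defensive.

Import Order.TTheory GRing.Theory Num.Theory.
Import numFieldNormedType.Exports.

Local Open Scope ring_scope.

Local Notation Re := complex.Re.
Local Notation Im := complex.Im.
Local Notation "x %:C" := (real_complex _ x) : ring_scope.
Local Notation "x +i* y" := (Complex x y) : ring_scope.

(** * The real-valued modulus on the complex numbers *)

Section ComplexModulus.
Variable R : realType.
Local Notation C := R[i].
Implicit Types (x y : R) (z w : C).

(** Since |z - b| = |1 - conj b z| for |z| = 1, |R| on the circle does not distinguish a pole from
    its reflection, up to constants; this is why [mu] sees only the symmetrised multiplicities. The
    space of all P / D_B has dimension n + 1, and [1 + poisson_sum B u] is the diagonal of its
    reproducing kernel for the measure dt / (2 pi); the 1 comes from the constant function.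
    Orthogonality rests on the mean value property, obtained here from the integrals of exp (i k t)
    and a contraction argument for each factor of D_B instead of contour integration. Passing to R^m
    repeats each pole m times, hence the factor m_p in front of [mu]. In the resulting estimate sup
    |R| stands on both sides, so it must be known to be finite before a power of it is cancelled.
    For sharpness all n poles are put at r / d: at the point r of the circle every Poisson kernel
    then attains its maximum (1 + d) / (1 - d), so both bounds coincide. *)

Lemma sqr_cmodE z : cmod z ^+ 2 = Re z ^+ 2 + Im z ^+ 2.
Proof. by case: z => a b; rewrite /cmod /= sqr_sqrtr // addr_ge0 ?sqr_ge0. Qed.

Lemma cmod_ge0 z : 0 <= cmod z.
Proof. by case: z => a b; exact: sqrtr_ge0. Qed.

Lemma cmod0 : cmod (0 : C) = 0. Proof. exact: ComplexField.Normc.normc0. Qed.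

Lemma cmod1 : cmod (1 : C) = 1. Proof. exact: ComplexField.Normc.normc1. Qed.

Lemma cmodM z w : cmod (z * w) = cmod z * cmod w.
Proof. exact: ComplexField.Normc.normcM. Qed.

Lemma cmodV z : cmod z^-1 = (cmod z)^-1.
Proof. exact: ComplexField.Normc.normcV. Qed.

Lemma cmod_eq0 z : (cmod z == 0) = (z == 0).
Proof.
by apply/eqP/eqP => [/ComplexField.Normc.eq0_normc //|->]; rewrite cmod0.
Qed.

Lemma cmod_gt0 z : (0 < cmod z) = (z != 0).
Proof. by rewrite lt_def cmod_ge0 cmod_eq0 andbT. Qed.

Lemma cmodD z w : cmod (z + w) <= cmod z + cmod w.
Proof. exact: le_normcD. Qed.

Lemma cmodN z : cmod (- z) = cmod z. Proof. exact: normcN. Qed.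

Lemma cmodB z w : cmod z - cmod w <= cmod (z - w).
Proof. by rewrite lerBlDr -{1}(subrK w z) cmodD. Qed.

Lemma cmodX z n : cmod (z ^+ n) = cmod z ^+ n.
Proof. by elim: n => [|n IH]; rewrite ?expr0 ?cmod1// !exprS cmodM IH. Qed.

Lemma cmod_prod (I : Type) (s : seq I) (F : I -> C) :
  cmod (\prod_(i <- s) F i) = \prod_(i <- s) cmod (F i).
Proof. by apply: (big_morph _ cmodM cmod1). Qed.

Lemma cmodJ z : cmod z^* = cmod z.
Proof. by case: z => a b; rewrite /cmod /= sqrrN. Qed.

Lemma cmod_real x : cmod x%:C = `|x|.
Proof. by rewrite /cmod /= expr0n addr0 sqrtr_sqr. Qed.

Lemma sqr_cmod z : (cmod z ^+ 2)%:C = z * z^*.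
Proof.
rewrite sqr_cmodE; case: z => a b.
by apply/eqP; rewrite eq_complex /=; apply/andP; split; apply/eqP; ring.
Qed.

Lemma mulcJ1 z : cmod z = 1 -> z * z^* = 1.
Proof. by move=> z1; rewrite -sqr_cmod z1 expr1n. Qed.

Lemma abs_Re_le z : `|Re z| <= cmod z.
Proof.
by rewrite -ler_sqr ?nnegrE ?cmod_ge0// sqr_cmodE real_normK ?num_real// lerDl sqr_ge0.
Qed.

Lemma abs_Im_le z : `|Im z| <= cmod z.
Proof.
by rewrite -ler_sqr ?nnegrE ?cmod_ge0// sqr_cmodE real_normK ?num_real// lerDr sqr_ge0.
Qed.

Lemma ReM z w : Re (z * w) = Re z * Re w - Im z * Im w.
Proof. by case: z w => a b [c d]. Qed.

Lemma ImM z w : Im (z * w) = Re z * Im w + Im z * Re w.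
Proof. by case: z w => a b [c d]. Qed.

Lemma ReD z w : Re (z + w) = Re z + Re w.
Proof. by case: z w => a b [c d]. Qed.

Lemma ImD z w : Im (z + w) = Im z + Im w.
Proof. by case: z w => a b [c d]. Qed.

Lemma ReJ z : Re z^* = Re z. Proof. by case: z. Qed.

Lemma ImJ z : Im z^* = - Im z. Proof. by case: z. Qed.

Lemma invc_conj z : z^-1 = z^* * ((cmod z ^+ 2)^-1)%:C.
Proof.
have [->|z0] := eqVneq z 0; first by rewrite invr0 rmorph0 mul0r.
by rewrite fmorphV /= sqr_cmod invfM mulrCA divff ?mulr1 // conjC_eq0.
Qed.

End ComplexModulus.

(** * Integrals of complex-valued functions over one period *)

Section CircleIntegral.
Variable R : realType.
Local Open Scope classical_set_scope.
Local Notation C := R[i].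
Local Notation leb := (@lebesgue_measure R).
Local Notation I2pi := (`[0, 2 * pi]%classic : set R).
Implicit Types (f g : R -> R) (h k : R -> C).

(** Continuity is asked coordinatewise because [cint] integrates real and imaginary parts
    separately. *)
Definition ccont h := continuous (fun t => Re (h t)) /\ continuous (fun t => Im (h t)).

Lemma ccont_cst (c : C) : ccont (fun=> c).
Proof. by split => t; exact: cvg_cst. Qed.

Lemma ccontD h k : ccont h -> ccont k -> ccont (fun t => h t + k t).
Proof.
move=> [h1 h2] [k1 k2]; split => t.
- under eq_fun do rewrite ReD.
  by apply: cvgD; [exact: h1|exact: k1].
- under eq_fun do rewrite ImD.
  by apply: cvgD; [exact: h2|exact: k2].
Qed.

Lemma ccontM h k : ccont h -> ccont k -> ccont (fun t => h t * k t).
Proof.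
move=> [h1 h2] [k1 k2]; split => t.
- under eq_fun do rewrite ReM.
  apply: cvgB; apply: cvgM; solve [exact: h1|exact: k1|exact: h2|exact: k2].
- under eq_fun do rewrite ImM.
  apply: cvgD; apply: cvgM; solve [exact: h1|exact: k1|exact: h2|exact: k2].
Qed.

Lemma ccontJ h : ccont h -> ccont (fun t => (h t)^*).
Proof.
move=> [h1 h2]; split => t.
- under eq_fun do rewrite ReJ.
  by exact: h1.
- under eq_fun do rewrite ImJ.
  by apply: cvgN; exact: h2.
Qed.

Lemma continuous_sqr_cmod h : ccont h -> continuous (fun t => cmod (h t) ^+ 2).
Proof.
move=> [h1 h2] t; under eq_fun do rewrite sqr_cmodE !expr2.
apply: cvgD; apply: cvgM; solve [exact: h1|exact: h2].
Qed.

Lemma continuous_cmod h : ccont h -> continuous (fun t => cmod (h t)).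
Proof.
move=> hc t.
have E (z : C) : cmod z = Num.sqrt (cmod z ^+ 2).
  by rewrite sqrtr_sqr ger0_norm ?cmod_ge0.
under eq_fun do rewrite E.
apply: (@continuous_comp _ _ _ (fun t => cmod (h t) ^+ 2) Num.sqrt).
  exact: continuous_sqr_cmod.
exact: sqrt_continuous.
Qed.

Lemma ccont_real f : continuous f -> ccont (fun t => (f t)%:C).
Proof. by move=> fc; split => t; [exact: fc|exact: cvg_cst]. Qed.

Lemma ccontV h : (forall t, h t != 0) -> ccont h -> ccont (fun t => (h t)^-1).
Proof.
move=> h0 hc; under eq_fun do rewrite invc_conj.
apply: ccontM; first exact: ccontJ.
apply: ccont_real => t; apply: cvgV; last exact: continuous_sqr_cmod.
by rewrite expf_neq0 // cmod_eq0.
Qed.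

Lemma ccontX h n : ccont h -> ccont (fun t => h t ^+ n).
Proof.
move=> hc; elim: n => [|n IH]; first exact: ccont_cst.
by under eq_fun do rewrite exprS; exact: ccontM.
Qed.

Lemma ccont_sum (I : Type) (s : seq I) (F : I -> R -> C) :
  (forall i, ccont (F i)) -> ccont (fun t => \sum_(i <- s) F i t).
Proof.
move=> Fc; elim: s => [|i s IH].
  by under eq_fun do rewrite big_nil; exact: ccont_cst.
by under eq_fun do rewrite big_cons; exact: ccontD.
Qed.

Lemma ccont_horner (p : {poly C}) h : ccont h -> ccont (fun t => p.[h t]).
Proof.
move=> hc; under eq_fun do rewrite horner_coef.
by apply: ccont_sum => i; apply: ccontM; [exact: ccont_cst|exact: ccontX].
Qed.

Lemma twopi_gt0 : 0 < 2 * pi :> R.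
Proof. by rewrite mulr_gt0 ?pi_gt0. Qed.

Lemma measurable_I2pi : measurable I2pi.
Proof. exact: measurable_itv. Qed.

Lemma integrable_I2pi f : continuous f -> leb.-integrable I2pi (EFin \o f).
Proof.
move=> fc; apply: continuous_compact_integrable; first exact: segment_compact.
exact: continuous_subspaceT.
Qed.

Lemma Rintegral_I2pi_cst (c : R) : \int[leb]_(t in I2pi) c = 2 * pi * c.
Proof.
rewrite Rintegral_cst; last exact: measurable_I2pi.
have muE : leb I2pi = (2 * pi)%:E.
  by rewrite lebesgue_measure_itv /= lte_fin twopi_gt0 -EFinB subr0.
by rewrite [X in fine X](_ : _ = (2 * pi)%:E) /= 1?[LHS]mulrC //; exact: muE.
Qed.

Definition cint h : C :=
  (\int[leb]_(t in I2pi) Re (h t)) +i* (\int[leb]_(t in I2pi) Im (h t)).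

Lemma cintD h k : ccont h -> ccont k ->
  cint (fun t => h t + k t) = cint h + cint k.
Proof.
move=> [h1 h2] [k1 k2]; rewrite /cint.
under eq_Rintegral do rewrite ReD.
under [X in _ +i* X]eq_Rintegral do rewrite ImD.
by rewrite !RintegralD //; solve [exact: measurable_I2pi|exact: integrable_I2pi].
Qed.

Lemma cintZ (c : C) h : ccont h -> cint (fun t => c * h t) = c * cint h.
Proof.
move=> [h1 h2]; rewrite /cint.
have cc (a : R) f : continuous f -> continuous (fun t => a * f t).
  by move=> fc t; apply: cvgM; [exact: cvg_cst|exact: fc].
under eq_Rintegral do rewrite ReM.
under [X in _ +i* X]eq_Rintegral do rewrite ImM.
rewrite RintegralB ?RintegralD;
  try solve [exact: measurable_I2pi|apply: integrable_I2pi; exact: cc].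
rewrite !RintegralZl; try solve [exact: measurable_I2pi|exact: integrable_I2pi].
by case: c => a b; apply/eqP; rewrite eq_complex /= !eqxx.
Qed.

Lemma cintJ h : ccont h -> cint (fun t => (h t)^*) = (cint h)^*.
Proof.
move=> [h1 h2]; rewrite /cint /=.
under eq_Rintegral do rewrite ReJ.
under [X in _ +i* X]eq_Rintegral do rewrite ImJ -mulN1r.
rewrite RintegralZl ?mulN1r //; solve [exact: measurable_I2pi|exact: integrable_I2pi].
Qed.

Lemma cint_cst (c : C) : cint (fun=> c) = (2 * pi)%:C * c.
Proof.
rewrite /cint !Rintegral_I2pi_cst; case: c => a b.
by apply/eqP; rewrite eq_complex /=; apply/andP; split; apply/eqP; ring.
Qed.

Lemma cint0 : cint (fun=> 0) = 0. Proof. by rewrite cint_cst mulr0. Qed.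

Lemma cint_real f : cint (fun t => (f t)%:C) = (\int[leb]_(t in I2pi) f t)%:C.
Proof. by rewrite /cint /= Rintegral_I2pi_cst mulr0. Qed.

Lemma cint_sum (I : Type) (s : seq I) (F : I -> R -> C) :
  (forall i, ccont (F i)) ->
  cint (fun t => \sum_(i <- s) F i t) = \sum_(i <- s) cint (F i).
Proof.
move=> Fc; elim: s => [|i s IH].
  by rewrite big_nil; under eq_fun do rewrite big_nil; exact: cint0.
rewrite big_cons -IH -cintD //; last exact: ccont_sum.
by congr cint; apply/funext => t; rewrite big_cons.
Qed.

Lemma abs_Rintegral_le f (M : R) : continuous f -> (forall t, I2pi t -> `|f t| <= M) ->
  `|\int[leb]_(t in I2pi) f t| <= 2 * pi * M.
Proof.
move=> fc fM; rewrite -Rintegral_I2pi_cst.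
apply: le_trans (le_normr_Rintegral _ (integrable_I2pi fc)) _.
  exact: measurable_I2pi.
apply: le_Rintegral => //.
- apply: integrable_I2pi => t.
  by apply: (@continuous_comp _ _ _ f (@Num.norm _ R));
    [exact: fc|exact: norm_continuous].
- by apply: integrable_I2pi => t; exact: cvg_cst.
Qed.

(** The constant is 4 pi M rather than 2 pi M because real and imaginary parts are bounded
    separately; only the finiteness of the bound matters. *)
Lemma cmod_cint_le h (M : R) : ccont h -> (forall t, I2pi t -> cmod (h t) <= M) ->
  cmod (cint h) <= 4 * pi * M.
Proof.
move=> [h1 h2] hM.
have E (z : C) : z = (Re z)%:C + 'i * (Im z)%:C.
  case: z => a b; apply/eqP; rewrite eq_complex /=.
  by apply/andP; split; apply/eqP; ring.
rewrite (E (cint h)); apply: le_trans (cmodD _ _) _.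
rewrite cmodM !cmod_real.
have -> : cmod ('i : C) = 1 by rewrite /cmod /= expr0n expr1n add0r sqrtr1.
have := abs_Rintegral_le h1 (fun t It => le_trans (abs_Re_le _) (hM t It)).
have := abs_Rintegral_le h2 (fun t It => le_trans (abs_Im_le _) (hM t It)).
rewrite /cint /=; lra.
Qed.

Lemma ccont_bounded h : ccont h -> exists2 M, 0 <= M & forall t, I2pi t -> cmod (h t) <= M.
Proof.
move=> hc; have [|c _ H] := @EVT_max R (fun t => cmod (h t)) 0 (2 * pi) (ltW twopi_gt0).
  by apply: continuous_subspaceT; exact: continuous_cmod.
exists (cmod (h c)); first exact: cmod_ge0.
by move=> t It; apply: H.
Qed.

Definition expi (t : R) : C := cos t +i* sin t.

Lemma expiD s t : expi (s + t) = expi s * expi t.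
Proof.
apply/eqP; rewrite eq_complex /= sinD cosD.
by apply/andP; split; apply/eqP; ring.
Qed.

Lemma expiX t n : expi t ^+ n = expi (n%:R * t).
Proof.
elim: n => [|n IH]; first by rewrite mul0r /expi cos0 sin0 expr0.
by rewrite exprS IH -expiD; congr expi; rewrite -natr1; ring.
Qed.

Lemma cmod_expi t : cmod (expi t) = 1.
Proof. by rewrite /cmod /= cos2Dsin2 sqrtr1. Qed.

Lemma ccont_expi : ccont expi.
Proof. by split => t; [exact: continuous_cos|exact: continuous_sin]. Qed.

(** With a = n + 1, the primitives sin (a t) / a and - cos (a t) / a take equal values at 0 and 2
    pi. *)
Lemma cint_expiX n : cint (fun t => expi t ^+ n.+1) = 0.
Proof.
have E1 : expi (n.+1%:R * (2 * pi)) = 1.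
  by rewrite -expiX /expi mulr_natl cos2pi sin2pi expr1n.
pose a : R := n.+1%:R.
have a0 : a != 0 by rewrite pnatr_eq0.
have [cE sE] : cos (a * (2 * pi)) = 1 /\ sin (a * (2 * pi)) = 0.
  by case: E1.
have dmul (t : R) : is_derive t 1 ( *%R a) a.
  by apply: is_derive_eq (is_deriveZ _ _) _; rewrite /GRing.scale /= mulr1.
have dS (t : R) : is_derive t 1 (fun t => a^-1 * sin (a * t)) (cos (a * t)).
  apply: is_derive_eq (is_deriveZ _ (is_derive1_comp _ _)) _.
  by rewrite /GRing.scale /= mulrC -mulrA divff ?mulr1.
have dC (t : R) : is_derive t 1 (fun t => - a^-1 * cos (a * t)) (sin (a * t)).
  apply: is_derive_eq (is_deriveZ _ (is_derive1_comp _ _)) _.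
  by rewrite /GRing.scale /=; field.
have FTC (F f : R -> R) : (forall t : R, is_derive t 1 F (f t)) -> continuous f ->
    \int[leb]_(t in I2pi) f t = F (2 * pi) - F 0.
  move=> dF fc; rewrite /Rintegral (@continuous_FTC2 R f F) //=.
  - exact: twopi_gt0.
  - exact: continuous_subspaceT.
  - have cF : continuous F.
      move=> t; apply: differentiable_continuous; apply/derivable1_diffP.
      exact: ex_derive.
    split => [t _||]; first exact: ex_derive.
    + by apply: cvg_at_right_filter; exact: cF.
    + by apply: cvg_at_left_filter; exact: cF.
  - by move=> t _; rewrite derive1E derive_val.
have cm f : continuous f -> continuous (fun t => f (a * t)).
  by move=> fc t; apply: (@continuous_comp _ _ _ ( *%R a) f);
    [exact: mulrl_continuous|exact: fc].
rewrite /cint.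
under eq_Rintegral do rewrite expiX /=.
under [X in _ +i* X]eq_Rintegral do rewrite expiX /=.
rewrite (FTC _ _ dS (cm _ (@continuous_cos R))) (FTC _ _ dC (cm _ (@continuous_sin R))).
by rewrite cE sE !(mulr0 a) cos0 sin0 !mulr1 !mulr0 !subrr.
Qed.

End CircleIntegral.

(** * The orthogonal expansion and the pointwise L^2 bound on the unit circle *)

Section RationalOnUnitCircle.
Variable R : realType.
Local Open Scope classical_set_scope.
Local Notation C := R[i].
Local Notation leb := (@lebesgue_measure R).
Local Notation I2pi := (`[0, 2 * pi]%classic : set R).
Local Notation E := (@expi R).
Implicit Types (b u z : C) (B : seq C) (p q : {poly C}).

Lemma cmod1B_ge b z : cmod z = 1 -> 1 - cmod b <= cmod (1 - b^* * z).
Proof. by move=> z1; have := cmodB 1 (b^* * z); rewrite cmod1 cmodM cmodJ z1 mulr1. Qed.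

Lemma subr_conj_neq0 b z : cmod b < 1 -> cmod z = 1 -> 1 - b^* * z != 0.
Proof.
by move=> b1 z1; rewrite -cmod_gt0; apply: lt_le_trans (cmod1B_ge _ z1); rewrite subr_gt0.
Qed.

(* The integrals [I k] satisfy [I k = b^* * I k.+1] and are bounded, hence vanish. *)
Lemma cint_hardy_div (h : R -> C) b : ccont h -> cmod b < 1 ->
  (forall k, cint (fun t => E t ^+ k.+1 * h t) = 0) ->
  forall k, cint (fun t => E t ^+ k.+1 * (h t / (1 - b^* * E t))) = 0.
Proof.
move=> hc b1 h0 k.
have d0 t := subr_conj_neq0 b1 (cmod_expi t).
pose g t := h t / (1 - b^* * E t).
have gc : ccont g.
  apply: ccontM => //; apply: ccontV => //.
  under eq_fun do rewrite -mulNr.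
  apply: ccontD; first exact: ccont_cst.
  by apply: ccontM; [exact: ccont_cst|exact: ccont_expi].
have Eg_c j : ccont (fun t => E t ^+ j * g t).
  by apply: ccontM => //; apply: ccontX; exact: ccont_expi.
pose I j := cint (fun t => E t ^+ j.+1 * g t).
have step j : I j = b^* * I j.+1.
  rewrite /I -cintZ // -[RHS]add0r -(h0 j) -cintD; last 2 first.
  - by apply: ccontM => //; apply: ccontX; exact: ccont_expi.
  - by apply: ccontM => //; exact: ccont_cst.
  congr cint; apply/funext => t; rewrite /g (exprS _ j.+1).
  by move: (E t ^+ j.+1) (E t) (d0 t) => x y y0; field.
have [M M0 hM] := ccont_bounded gc.
pose A := [set x | exists j, x = cmod (I j)].
have ubA : has_sup A.
  split; first by exists (cmod (I 0%N)); exists 0%N.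
  exists (4 * pi * M) => _ [j ->]; apply: cmod_cint_le => // t It.
  by rewrite cmodM cmodX cmod_expi expr1n mul1r hM.
have supA : sup A <= cmod b * sup A.
  apply: ge_sup; first exact: ubA.1.
  move=> _ [j ->]; rewrite step cmodM cmodJ ler_wpM2l ?cmod_ge0 //.
  by apply: ub_le_sup; [exact: ubA.2|exists j.+1].
have Ik : cmod (I k) <= sup A by apply: ub_le_sup; [exact: ubA.2|exists k].
apply/eqP; rewrite -cmod_eq0 eq_le cmod_ge0 andbT; apply: le_trans Ik _.
by rewrite -subr_le0 -{1}[sup A]mul1r -mulrBl pmulr_rle0 ?subr_gt0 in supA.
Qed.

Definition blaschke_den B : {poly C} := \prod_(b <- B) (1 - b^* *: 'X).

Definition blaschke_num B : {poly C} := \prod_(b <- B) ('X - b%:P).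

Lemma horner_blaschke_den B z : (blaschke_den B).[z] = \prod_(b <- B) (1 - b^* * z).
Proof. by rewrite horner_prod; apply: eq_bigr => b _; rewrite !hornerE. Qed.

Lemma horner_blaschke_den_cons b B z :
  (blaschke_den (b :: B)).[z] = (1 - b^* * z) * (blaschke_den B).[z].
Proof. by rewrite !horner_blaschke_den big_cons. Qed.

Lemma horner_blaschke_num B z : (blaschke_num B).[z] = \prod_(b <- B) (z - b).
Proof. by rewrite horner_prod; apply: eq_bigr => b _; rewrite !hornerE. Qed.

Definition in_disc B := all (fun b => cmod b < 1) B.

Lemma blaschke_den_neq0 B z : in_disc B -> cmod z = 1 -> (blaschke_den B).[z] != 0.
Proof.
move=> /allP B1 z1; rewrite horner_blaschke_den prodf_seq_neq0.
by apply/allP => b bB; rewrite subr_conj_neq0 // B1.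
Qed.

(** On the circle conj z = 1 / z, so z - b = z conj (1 - conj b z) factor by factor. This trades a
    conjugated denominator for a polynomial. *)
Lemma conj_blaschke_den B z : cmod z = 1 ->
  (blaschke_num B).[z] = (blaschke_den B).[z]^* * z ^+ size B.
Proof.
move=> /mulcJ1 z1; rewrite horner_blaschke_num horner_blaschke_den.
elim: B => [|b B IH]; first by rewrite !big_nil rmorph1 mulr1.
rewrite !big_cons IH exprS rmorphM rmorphB rmorphM rmorph1 /=.
rewrite conjCK.
by rewrite -[in z - b](mulr1 b) -[in b * 1]z1; ring.
Qed.

Lemma cmod_blaschke B z : cmod z = 1 ->
  cmod (blaschke_num B).[z] = cmod (blaschke_den B).[z].
Proof.
by move=> z1; rewrite conj_blaschke_den // cmodM cmodJ cmodX z1 expr1n mulr1.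
Qed.

Lemma cmod_blaschke_factor b z : cmod z = 1 -> cmod (z - b) = cmod (1 - b^* * z).
Proof.
move=> z1; have := @cmod_blaschke [:: b] z z1.
by rewrite horner_blaschke_num horner_blaschke_den !big_seq1.
Qed.

Lemma ccont_expi_div p B : in_disc B -> ccont (fun t => p.[E t] / (blaschke_den B).[E t]).
Proof.
move=> B1; apply: ccontM; first by apply: ccont_horner; exact: ccont_expi.
apply: ccontV; last by apply: ccont_horner; exact: ccont_expi.
by move=> t; rewrite blaschke_den_neq0 // cmod_expi.
Qed.

(** Integrals against positive powers of [E t] are, up to 2 pi, the Fourier coefficients of negative
    index. They vanish for the constant 1, and dividing by one more factor of the denominator keeps
    them zero. *)
Lemma cint_expiX_div B k : in_disc B ->
  cint (fun t => E t ^+ k.+1 * (1 / (blaschke_den B).[E t])) = 0.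
Proof.
elim: B k => [|b B IH] k /=.
  move=> _; rewrite -(cint_expiX R k); congr cint; apply/funext => t.
  by rewrite /blaschke_den big_nil hornerC divr1 mulr1.
move=> /andP[b1 B1].
have hc : ccont (fun t => 1 / (blaschke_den B).[E t]).
  have := ccont_expi_div 1 B1.
  by under eq_fun do rewrite hornerC.
rewrite -(cint_hardy_div hc b1 _ k) => [|j]; last exact: IH.
congr cint; apply/funext => t; rewrite horner_blaschke_den_cons.
by rewrite !div1r invfM [in LHS](mulrC (_^-1)).
Qed.

(* The mean value property [f 0 = mean of f] for [f(z) = z p(z) / D(z)], whose poles
   lie outside the closed disc. *)
Lemma cint_mulX_div p B : in_disc B ->
  cint (fun t => E t * (p.[E t] / (blaschke_den B).[E t])) = 0.
Proof.
move=> B1; have c1 i : ccont (fun t => E t ^+ i.+1 * (1 / (blaschke_den B).[E t])).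
  apply: ccontM; first by apply: ccontX; exact: ccont_expi.
  have := ccont_expi_div 1 B1.
  by under eq_fun do rewrite hornerC.
rewrite [LHS](_ : _ = cint (fun t =>
    \sum_(i < size p) (p`_i * (E t ^+ i.+1 * (1 / (blaschke_den B).[E t]))))).
  rewrite cint_sum => [|i]; last by apply: ccontM => //; exact: ccont_cst.
  by rewrite big1 // => i _; rewrite cintZ // cint_expiX_div // mulr0.
congr cint; apply/funext => t; rewrite horner_coef mulr_suml mulr_sumr.
by apply: eq_bigr => i _; rewrite exprS; ring.
Qed.

Definition circle_sqnorm p B : R :=
  \int[leb]_(t in I2pi) cmod (p.[E t] / (blaschke_den B).[E t]) ^+ 2.

Lemma circle_sqnormE p B : (circle_sqnorm p B)%:C =
  cint (fun t => (p.[E t] / (blaschke_den B).[E t]) * (p.[E t] / (blaschke_den B).[E t])^*).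
Proof. by rewrite -cint_real; congr cint; apply/funext => t; rewrite sqr_cmod. Qed.

(** The left side evaluates the reciprocal polynomial z^n conj (p (1 / conj z)), and 1 / conj z = z
    on the circle. *)
Lemma horner_reverse p n z : (size p <= n.+1)%N -> cmod z = 1 ->
  (\poly_(i < n.+1) (p`_(n - i))^*).[z] = z ^+ n * p.[z]^*.
Proof.
move=> pn /mulcJ1 z1; rewrite horner_poly (horner_coef_wide _ pn) rmorph_sum mulr_sumr.
rewrite (reindex_inj rev_ord_inj) /=; apply: eq_bigr => i _.
have lein : (i <= n)%N by rewrite -ltnS.
rewrite !subSS subKn // rmorphM rmorphXn /=.
have -> : z ^+ n = z ^+ (n - i) * z ^+ i by rewrite -exprD subnK.
by rewrite mulrCA -[in RHS]mulrA -exprMn z1 expr1n mulr1.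
Qed.

Lemma sqr_cmod_lt1 b : cmod b < 1 -> 0 < 1 - cmod b ^+ 2.
Proof. by move=> b1; rewrite subr_gt0 expr_lt1 ?cmod_ge0. Qed.

(* Since [|N_B| = |D_B|] on the circle, this is the integral of a multiple of the
   Poisson kernel [1 + 2 Re (b^* z / (1 - b^* z))]. *)
Lemma cint_sqr_basis b B : cmod b < 1 -> in_disc B ->
  cint (fun t => let w := ('X * blaschke_num B).[E t] / (blaschke_den (b :: B)).[E t] in
    w * w^*) = (2 * pi / (1 - cmod b ^+ 2))%:C.
Proof.
move=> b1 B1; have nb := sqr_cmod_lt1 b1.
pose v t := (b^*)%:P.[E t] / (blaschke_den [:: b]).[E t].
have vc : ccont v by apply: ccont_expi_div; rewrite /= b1.
have Ev : ccont (fun t => E t * v t) by apply: ccontM => //; exact: ccont_expi.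
have Ev0 : cint (fun t => E t * v t) = 0 by apply: cint_mulX_div; rewrite /= b1.
rewrite [LHS](_ : _ = cint (fun t =>
    ((1 - cmod b ^+ 2)^-1)%:C * (1 + (E t * v t + (E t * v t)^*)))).
  rewrite cintZ; last by apply: ccontD; [exact: ccont_cst|apply: ccontD => //; exact: ccontJ].
  rewrite cintD; last 2 first; [exact: ccont_cst|by apply: ccontD => //; exact: ccontJ|].
  rewrite cintD //; last exact: ccontJ.
  by rewrite cintJ // Ev0 conjC0 !addr0 cint_cst mulr1 -rmorphM /= mulrC.
congr cint; apply/funext => t; set z := E t; have z1 : cmod z = 1 := cmod_expi t.
rewrite /= -sqr_cmod cmodM cmodV hornerM hornerX cmodM z1 mul1r cmod_blaschke //.
rewrite horner_blaschke_den_cons cmodM invfM mulrCA divff ?mulr1; last first.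
  by rewrite cmod_eq0; exact: blaschke_den_neq0.
rewrite -cmodV sqr_cmod /v horner_blaschke_den big_seq1 hornerC -/z.
have d0 : 1 - b^* * z != 0 by exact: subr_conj_neq0.
have cj : (1 - b^* * z)^* = 1 - b * z^* by rewrite rmorphB rmorph1 rmorphM /= conjCK.
have d0' : 1 - b * z^* != 0 by rewrite -cj conjC_eq0.
have zz := mulcJ1 z1.
have nbC : 1 - b * b^* != 0.
  have -> : 1 - b * b^* = (1 - cmod b ^+ 2)%:C by rewrite rmorphB rmorph1 /= sqr_cmod.
  by rewrite fmorph_eq0 lt0r_neq0.
have -> : ((1 - cmod b ^+ 2)^-1)%:C = (1 - b * b^*)^-1.
  by rewrite fmorphV rmorphB rmorph1 /= sqr_cmod.
rewrite !rmorphM !fmorphV /= cj conjCK.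
have -> : 1 + (z * (b^* / (1 - b^* * z)) + z^* * (b / (1 - b * z^*))) =
    (1 - b * b^* * (z * z^*)) / ((1 - b^* * z) * (1 - b * z^*)).
  by move: (b^*) (z^*) d0 d0' => x y d0 d0'; field; rewrite d0 d0'.
rewrite zz mulr1; move: (b^*) (z^*) d0 d0' nbC => x y d0 d0' nbC; field.
by rewrite nbC d0 d0'.
Qed.

(* On the circle, the cross term is [z q(z) / D_(b :: B)(z)] with [q] the reversal of
   the conjugate of [p], so its integral vanishes. *)
Lemma circle_sqnormD (c : C) p B b : in_disc (b :: B) -> (size p <= (size B).+1)%N ->
  circle_sqnorm (c *: ('X * blaschke_num B) + (1 - b^* *: 'X) * p) (b :: B) =
  cmod c ^+ 2 * (2 * pi / (1 - cmod b ^+ 2)) + circle_sqnorm p B.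
Proof.
move=> bB sp; have /andP[b1 B1] : (cmod b < 1) && in_disc B by [].
pose w t := ('X * blaschke_num B).[E t] / (blaschke_den (b :: B)).[E t].
pose g t := p.[E t] / (blaschke_den B).[E t].
have wc : ccont w by exact: ccont_expi_div.
have gc : ccont g by exact: ccont_expi_div.
have wg0 : cint (fun t => w t * (g t)^*) = 0.
  rewrite -(cint_mulX_div (\poly_(i < (size B).+1) (p`_(size B - i))^*) bB).
  congr cint; apply/funext => t; set z := E t; have z1 : cmod z = 1 := cmod_expi t.
  rewrite horner_reverse // /w /g -/z hornerM hornerX conj_blaschke_den //.
  rewrite rmorphM fmorphV /=.
  have D0 := blaschke_den_neq0 bB z1; have D1 : (blaschke_den B).[z]^* != 0.
    by rewrite conjC_eq0 blaschke_den_neq0.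
  move: (blaschke_den B).[z]^* (blaschke_den (b :: B)).[z] (z ^+ size B) p.[z]^* D0 D1.
  by move=> x y e q y0 x0; field; rewrite x0 y0.
have wgc : ccont (fun t => w t * (g t)^*) by apply: ccontM => //; exact: ccontJ.
have cst d : ccont (fun=> d) by exact: ccont_cst.
apply: complexI; rewrite circle_sqnormE rmorphD rmorphM /= circle_sqnormE.
rewrite -(cint_sqr_basis b1 B1) sqr_cmod.
rewrite [LHS](_ : _ = cint (fun t => (c * c^*) * (w t * (w t)^*) +
    (g t * (g t)^* + (c * (w t * (g t)^*) + (c * (w t * (g t)^*))^*)))); last first.
  congr cint; apply/funext => t; set z := E t; have z1 : cmod z = 1 := cmod_expi t.
  have d0 := subr_conj_neq0 b1 z1.
  have -> : (c *: ('X * blaschke_num B) + (1 - b^* *: 'X) * p).[z] /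
      (blaschke_den (b :: B)).[z] = c * w t + g t.
    rewrite /w /g -/z hornerD hornerZ mulrDl mulrA; congr (_ + _).
    rewrite horner_blaschke_den_cons hornerM hornerD hornerN hornerZ hornerX hornerC.
    by rewrite invfM mulrACA divff // mul1r.
  by move: (w t) (g t) => x y; rewrite !rmorphD !rmorphM /= conjCK; ring.
have cwg : ccont (fun t => c * (w t * (g t)^*)) by exact: ccontM.
have gg : ccont (fun t => g t * (g t)^*) by apply: ccontM => //; exact: ccontJ.
have ww : ccont (fun t => w t * (w t)^*) by apply: ccontM => //; exact: ccontJ.
have cJ := ccontJ cwg.
rewrite cintD; last 2 first; [exact: ccontM|by do 2 (apply: ccontD => //)|].
rewrite cintD //; last exact: ccontD.
rewrite cintD // cintJ // !cintZ // wg0 mulr0 conjC0 !addr0.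
by [].
Qed.

Lemma size_blaschke_num B : size (blaschke_num B) = (size B).+1.
Proof. by rewrite size_prod_XsubC. Qed.

Lemma mulX_blaschke_num_monic B : 'X * blaschke_num B \is monic.
Proof. by rewrite monicMl ?monicX // monic_prod_XsubC. Qed.

Lemma size_mulX_blaschke_num B : size ('X * blaschke_num B) = (size B).+2.
Proof.
by rewrite mulrC size_mulX ?size_blaschke_num // -size_poly_eq0 size_blaschke_num.
Qed.

(** Evaluation at u = 1 / conj b, the zero of the second factor, dictates c = p(u) / N(u); N(u) is
    nonzero because N vanishes only at points of the disc, while |u| > 1. The remainder p - c N
    vanishes at u, so the factor divides it and the degree drops by one. *)
Lemma basis_decomp p b B : in_disc (b :: B) -> (size p <= (size B).+2)%N ->
  exists c q, (size q <= (size B).+1)%N /\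
    p = c *: ('X * blaschke_num B) + (1 - b^* *: 'X) * q.
Proof.
move=> /andP[b1 /allP B1] sp; set N := 'X * blaschke_num B.
have sN : size N = (size B).+2 by exact: size_mulX_blaschke_num.
(* For b = 0 the second factor is 1 and has no zero; c is then the top coefficient of [p], which
   subtracting a multiple of the monic [N] removes. *)
have [b0|b0] := eqVneq b 0.
  exists p`_(size B).+1, (p - p`_(size B).+1 *: N); split; last first.
    by rewrite b0 conjC0 scale0r subr0 mul1r addrC subrK.
  apply/leq_sizeP => j; rewrite leq_eqVlt => /predU1P[<-|lt_j].
    rewrite coefB coefZ; have := mulX_blaschke_num_monic B.
    by rewrite monicE lead_coefE -/N sN /= => /eqP ->; rewrite mulr1 subrr.
  by rewrite coefB coefZ (nth_default 0 (leq_trans sp lt_j)) (@nth_default _ 0 N)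
    ?sN // mulr0 subrr.
pose u := (b^*)^-1; have u0 : u != 0 by rewrite invr_eq0 conjC_eq0.
have u1 : 1 < cmod u by rewrite cmodV cmodJ invf_gt1 // cmod_gt0.
have Nu : N.[u] != 0.
  rewrite hornerM hornerX mulf_neq0 // horner_blaschke_num prodf_seq_neq0.
  apply/allP => a aB; apply/implyP => _; rewrite subr_eq0; apply: contraTneq u1 => ->.
  by rewrite -leNgt ltW // B1.
pose c := p.[u] / N.[u].
have : root (p - c *: N) u.
  by rewrite /root hornerD hornerN hornerZ /c divfK // subrr.
(* The scalar comes from ['X - u = - u (1 - conj b 'X)]. *)
case/factor_theorem => q pq; exists c, (- u *: q); split; last first.
  apply/eqP; rewrite addrC -subr_eq pq; apply/eqP.
  rewrite -scalerAr scalerAl mulrC; congr (_ * _).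
  rewrite scalerBr scalerA mulNr mulVf ?conjC_eq0 // scaleN1r opprK.
  by rewrite alg_polyC polyCN addrC.
rewrite (leq_trans (size_scale_leq _ _)) //.
have [->|q0] := eqVneq q 0; first by rewrite size_poly0.
have : (size (p - c *: N)%R <= (size B).+2)%N.
  rewrite (leq_trans (size_polyD _ _)) // size_polyN geq_max sp /= -sN.
  exact: size_scale_leq.
by rewrite pq size_Mmonic ?monicXsubC // size_XsubC addn2.
Qed.

Definition poisson_sum B u : R :=
  \sum_(b <- B) (1 - cmod b ^+ 2) / cmod (u - b) ^+ 2.

Lemma poisson_sum_ge0 B u : in_disc B -> 0 <= poisson_sum B u.
Proof.
move=> /allP B1; rewrite /poisson_sum big_seq sumr_ge0 // => b /B1 b1.
by rewrite divr_ge0 ?sqr_ge0 // ltW // sqr_cmod_lt1.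
Qed.

Lemma circle_sqnorm_ge0 p B : 0 <= circle_sqnorm p B.
Proof. by apply: Rintegral_ge0 => t _; exact: sqr_ge0. Qed.

(** Cauchy-Schwarz is applied two terms at a time, by induction on [B]: the value splits as x + y
    with |x|^2 = w T and, inductively, |y|^2 <= (1 + P) S, where T and S are the normalised squared
    norms of the two orthogonal parts. Hence |x + y|^2 <= (w + 1 + P) (T + S). *)
Lemma sqr_eval_le p B u : in_disc B -> (size p <= (size B).+1)%N -> cmod u = 1 ->
  cmod (p.[u] / (blaschke_den B).[u]) ^+ 2 <=
  (1 + poisson_sum B u) * (circle_sqnorm p B / (2 * pi)).
Proof.
have pi2 := twopi_gt0 R.
move=> B1 sp u1; elim: B p B1 sp => [|b B IH] p B1 sp.
  have [c ->] : exists c, p = c%:P by exists p`_0; rewrite -size1_polyC.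
  rewrite /circle_sqnorm /poisson_sum big_nil addr0 mul1r /blaschke_den big_nil.
  rewrite !hornerC divr1.
  under eq_Rintegral do rewrite !hornerC divr1.
  by rewrite Rintegral_I2pi_cst mulrAC divff ?mul1r // gt_eqF.
have [c [q [sq ->]]] := basis_decomp B1 sp.
rewrite circle_sqnormD // /poisson_sum big_cons -/(poisson_sum B u).
have /andP[b1 B1'] : (cmod b < 1) && in_disc B by [].
have nb := sqr_cmod_lt1 b1.
have d0 := subr_conj_neq0 b1 u1.
rewrite horner_blaschke_den_cons !(hornerD, hornerN, hornerZ, hornerM, hornerX, hornerC).
have D0 := blaschke_den_neq0 B1' u1.
set x := c * (u * (blaschke_num B).[u]) / ((1 - b^* * u) * (blaschke_den B).[u]).
set y := q.[u] / (blaschke_den B).[u].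
rewrite [X in cmod X](_ : _ = x + y); last first.
  by rewrite /x /y mulrDl; congr (_ + _); rewrite invfM mulrACA divff // mul1r.
have hx : cmod x ^+ 2 = cmod c ^+ 2 / cmod (u - b) ^+ 2.
  rewrite /x cmodM cmodV !cmodM u1 mul1r cmod_blaschke // cmod_blaschke_factor //.
  have : cmod (blaschke_den B).[u] != 0 by rewrite cmod_eq0.
  have : cmod (1 - b^* * u) != 0 by rewrite cmod_eq0.
  by move=> h1 h2; field; rewrite h1 h2.
have hy := IH q B1' sq; rewrite -/y in hy.
have K0 := poisson_sum_ge0 u B1'.
have sxy : cmod (x + y) <= cmod x + cmod y := cmodD x y.
set P := poisson_sum B u in hy K0 *.
set S := circle_sqnorm q B / (2 * pi) in hy *.
have w0 : 0 < cmod (u - b) ^+ 2.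
  by rewrite exprn_gt0 // cmod_blaschke_factor // cmod_gt0.
set w := (1 - cmod b ^+ 2) / cmod (u - b) ^+ 2.
have w_gt0 : 0 < w by exact: divr_gt0.
pose T := cmod c ^+ 2 / (1 - cmod b ^+ 2).
have -> : (cmod c ^+ 2 * (2 * pi / (1 - cmod b ^+ 2)) + circle_sqnorm q B) / (2 * pi) = T + S.
  rewrite /T /S; move: (2 * pi) (1 - cmod b ^+ 2) pi2 nb => a d a0 e0.
  by field; rewrite !gt_eqF.
have {}hx : cmod x ^+ 2 = w * T.
  rewrite hx /w /T; move: (cmod (u - b) ^+ 2) (1 - cmod b ^+ 2) w0 nb => a d a0 e0.
  by field; rewrite !gt_eqF.
have T0 : 0 <= T by rewrite divr_ge0 ?sqr_ge0 // ltW.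
have S0 : 0 <= S by rewrite divr_ge0 ?circle_sqnorm_ge0 // ltW.
have := cmod_ge0 x; have := cmod_ge0 y; have := cmod_ge0 (x + y).
move: (cmod x) (cmod y) (cmod (x + y)) hx hy sxy => X Y Z hx hy sxy Z0 Y0 X0.
have Z2 : Z ^+ 2 <= (X + Y) ^+ 2 by rewrite ler_sqr ?nnegrE ?addr_ge0.
apply: le_trans Z2 _.
(* AM-GM: [(X Y)^2 <= (w S) ((1 + P) T)], whose square root is at most the mean *)
have P1_gt0 : 0 < 1 + P by rewrite ltr_wpDr.
have XY : 2 * (X * Y) <= w * S + (1 + P) * T.
  have h0 : 0 <= w * S + (1 + P) * T.
    by apply: addr_ge0; apply: mulr_ge0 => //; exact: ltW.
  rewrite -ler_sqr ?nnegrE ?mulr_ge0 //.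
  have -> : (2 * (X * Y)) ^+ 2 = 4 * (X ^+ 2 * Y ^+ 2) by ring.
  have : X ^+ 2 * Y ^+ 2 <= w * T * ((1 + P) * S).
    by rewrite hx ler_wpM2l //; apply: mulr_ge0 => //; exact: ltW.
  have : 0 <= (w * S - (1 + P) * T) ^+ 2 by exact: sqr_ge0.
  lra.
lra.
Qed.

End RationalOnUnitCircle.

(** * From exponent 2 to an arbitrary finite exponent *)

Section CircleLp.
Variable R : realType.
Local Open Scope classical_set_scope.
Local Notation C := R[i].
Local Notation leb := (@lebesgue_measure R).
Local Notation I2pi := (`[0, 2 * pi]%classic : set R).
Local Notation E := (@expi R).
Implicit Types (u z : C) (B : seq C) (p q : {poly C}).

(** Being bounded and measurable suffices, so continuity of the power at zeros of [g] does not
    enter. *)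
Lemma integrable_powR_I2pi (g : R -> R) (s : R) : 0 <= s -> continuous g ->
  (forall t, 0 <= g t) -> leb.-integrable I2pi (EFin \o (fun t => g t `^ s)).
Proof.
move=> s0 gc g0.
have [c _ gM] : exists2 c, c \in `[0, 2 * pi]%R & forall t, t \in `[0, 2 * pi]%R -> g t <= g c.
  by apply: EVT_max (ltW (twopi_gt0 R)) _; exact: continuous_subspaceT.
apply: measurable_bounded_integrable.
- exact: measurable_I2pi.
- have : leb I2pi = (2 * pi)%:E.
    by rewrite lebesgue_measure_itv /= lte_fin twopi_gt0 -EFinB subr0.
  by move=> e; rewrite (_ : (_ < _)%E = (leb I2pi < +oo)%E) // e ltry.
- apply: measurable_funTS; apply: (measurableT_comp (measurable_powR s)).
  exact: continuous_measurable_fun.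
- exists (g c `^ s); split; rewrite ?num_real // => x Mx t It /=.
  rewrite ger0_norm ?powR_ge0 // (le_trans _ (ltW Mx)) //.
  by rewrite ge0_ler_powR ?nnegrE //; exact: gM.
Qed.

Definition quotient_cmod p B z : R := cmod (p.[z] / (blaschke_den B).[z]).

Lemma quotient_cmod_ge0 p B z : 0 <= quotient_cmod p B z.
Proof. exact: cmod_ge0. Qed.

Lemma continuous_quotient_cmod p B : in_disc B ->
  continuous (fun t => quotient_cmod p B (E t)).
Proof. by move=> B1; apply: continuous_cmod; exact: ccont_expi_div. Qed.

Definition power_poles m B : seq C := flatten (nseq m B).

Lemma in_disc_power_poles m B : in_disc B -> in_disc (power_poles m B).
Proof. by move=> B1; elim: m => //= m IH; rewrite /in_disc all_cat -/(in_disc _) B1. Qed.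

Lemma big_power_poles (T : Type) (idx : T) (op : Monoid.law idx) (F : C -> T) m B :
  \big[op/idx]_(b <- power_poles m B) F b = iterop m op (\big[op/idx]_(b <- B) F b) idx.
Proof.
elim: m => [|m IH]; first by rewrite big_nil.
rewrite /= big_cat /= IH; case: m {IH} => [|m] //=.
by rewrite Monoid.mulm1.
Qed.

Lemma blaschke_den_power m B : blaschke_den (power_poles m B) = blaschke_den B ^+ m.
Proof. by rewrite /blaschke_den big_power_poles. Qed.

Lemma poisson_sum_power m B u : poisson_sum (power_poles m B) u = m%:R * poisson_sum B u.
Proof.
rewrite /poisson_sum big_power_poles mulr_natl.
by elim: m => // m IH; rewrite mulrS -IH; case: m {IH} => //=; rewrite addr0.
Qed.

Lemma size_power_poles m B : size (power_poles m B) = (m * size B)%N.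
Proof. by rewrite size_flatten /shape map_nseq sumn_nseq mulnC. Qed.

Lemma quotient_cmod_power m p B z :
  quotient_cmod (p ^+ m) (power_poles m B) z = quotient_cmod p B z ^+ m.
Proof. by rewrite /quotient_cmod blaschke_den_power !horner_exp -exprVn -exprMn cmodX. Qed.

(** This is [sqr_eval_le] for p^m over the m-fold list of poles: the Poisson sum is multiplied by m
    and the square becomes the exponent 2 m. *)
Lemma quotient_cmod_power_le m p B u : in_disc B -> (size p <= (size B).+1)%N ->
  cmod u = 1 ->
  quotient_cmod p B u ^+ (2 * m) <= (1 + m%:R * poisson_sum B u) / (2 * pi) *
    \int[leb]_(t in I2pi) quotient_cmod p B (E t) ^+ (2 * m).
Proof.
move=> B1 sp u1; have := @sqr_eval_le R (p ^+ m) (power_poles m B) u.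
rewrite -/(quotient_cmod _ _ _) quotient_cmod_power poisson_sum_power.
rewrite -exprM mulnC mulrAC mulrA /circle_sqnorm.
under eq_Rintegral do rewrite -/(quotient_cmod _ _ _) quotient_cmod_power -exprM mulnC.
move=> -> //; first exact: in_disc_power_poles.
rewrite size_power_poles (leq_trans (size_poly_exp_leq _ _)) // ltnS mulnC leq_mul2l.
by apply/orP; right; case: (size p) sp.
Qed.

(** With n = 2 m and S the supremum of g, the estimate for g^n together with g^n <= S^(n - s) g^s
    gives S^n <= K S^(n - s) J, and cancelling leaves S^s <= K J. [M] is an arbitrary bound so that
    the result also yields boundedness of R on the circle. *)
Lemma quotient_cmod_powR_le p B (s M : R) m : in_disc B -> (size p <= (size B).+1)%N ->
  0 < s -> s / 2 <= m%:R ->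
  (forall u, cmod u = 1 -> poisson_sum B u <= M) ->
  forall u, cmod u = 1 -> quotient_cmod p B u `^ s <= (m%:R * M + 1) / (2 * pi) *
    \int[leb]_(t in I2pi) (quotient_cmod p B (E t) `^ s).
Proof.
move=> B1 sp s0 sm BM; pose g := quotient_cmod p B.
have g0 u : 0 <= g u by exact: quotient_cmod_ge0.
have gc := @continuous_quotient_cmod p B B1; rewrite -/g in gc.
have pi2 := twopi_gt0 R.
have cmod1' : cmod (1 : C) = 1 by exact: cmod1.
have M0 : 0 <= M by apply: le_trans (BM 1 cmod1'); exact: poisson_sum_ge0.
have m0 : (0 < m)%N.
  by rewrite -(ltr_nat R) (lt_le_trans _ sm) // divr_gt0.
pose n := (2 * m)%N; have n0 : (0 < n)%N by rewrite muln_gt0.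
have nR : n%:R != 0 :> R by rewrite pnatr_eq0 -lt0n.
have sn : s <= n%:R by rewrite natrM; lra.
pose K := (m%:R * M + 1) / (2 * pi).
have K0 : 0 <= K by apply: divr_ge0; [rewrite addr_ge0 // mulr_ge0|exact: ltW].
have cX k : continuous (fun t => g (E t) ^+ k).
  by move=> t; apply: (@continuous_comp _ _ _ (fun t => g (E t)) (fun x => x ^+ k));
    [exact: gc|exact: exprn_continuous].
have gK u : cmod u = 1 -> g u ^+ n <= K * \int[leb]_(t in I2pi) g (E t) ^+ n.
  move=> u1; apply: le_trans (quotient_cmod_power_le m B1 sp u1) _.
  rewrite ler_wpM2r //; first by apply: Rintegral_ge0 => t _; rewrite exprn_ge0.
  apply: ler_wpM2r; first by rewrite invr_ge0 ltW.
  by rewrite addrC lerD2r ler_wpM2l // BM.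
pose S := sup [set x | exists2 u, cmod u = 1 & x = g u].
(* Finiteness of S: where g exceeds 1 it is at most g^n, which the estimate [gK] bounds. *)
have ubS : has_ubound [set x | exists2 u, cmod u = 1 & x = g u].
  exists (1 + K * \int[leb]_(t in I2pi) g (E t) ^+ (2 * m)) => _ [u u1 ->].
  have [g1|g1] := leP (g u) 1.
    rewrite (le_trans g1) // lerDl mulr_ge0 //.
    by apply: Rintegral_ge0 => t _; rewrite exprn_ge0.
  by rewrite (le_trans _ (le_trans (gK u u1) _)) ?lerDr // ler_eXnr // ltW.
have gS u : cmod u = 1 -> g u <= S by move=> u1; apply: ub_le_sup => //; exists u.
have S0 : 0 <= S by exact: le_trans (gS 1 cmod1').
pose J := \int[leb]_(t in I2pi) (g (E t) `^ s).
have J0 : 0 <= J by apply: Rintegral_ge0 => t _; exact: powR_ge0.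
suff SJ : S `^ s <= K * J.
  by move=> u u1; apply: le_trans SJ; rewrite ge0_ler_powR ?nnegrE ?gS // ltW.
(* If S = 0 its powers cannot be cancelled, but the left side is then 0. *)
have [S_eq0|S_neq0] := eqVneq S 0.
  by rewrite S_eq0 powR0 ?gt_eqF // mulr_ge0.
have S_gt0 : 0 < S by rewrite lt_def S_neq0.
have gsn u : cmod u = 1 -> g u ^+ n <= S `^ (n%:R - s) * g u `^ s.
  move=> u1; have [->|gu0] := eqVneq (g u) 0.
    by rewrite expr0n gtn_eqF // mulr_ge0 ?powR_ge0.
  rewrite -powR_mulrn // -{1}(subrK s n%:R) powRD ?gu0 ?implybT //.
  by rewrite ler_wpM2r ?powR_ge0 // ge0_ler_powR ?nnegrE ?subr_ge0 ?gS.
have intJ : \int[leb]_(t in I2pi) g (E t) ^+ n <= S `^ (n%:R - s) * J.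
  have ints : leb.-integrable I2pi (EFin \o (fun t => g (E t) `^ s)).
    by apply: integrable_powR_I2pi => //; exact: ltW.
  rewrite /J -RintegralZl //; apply: le_Rintegral => //.
  - exact: integrable_I2pi.
  - apply: (@eq_integrable _ _ _ leb _ _
      (fun t => (S `^ (n%:R - s))%:E * (g (E t) `^ s)%:E)%E) => //.
    exact: integrableZl.
  - by move=> t _; apply: gsn; exact: cmod_expi.
pose X := K * (S `^ (n%:R - s) * J).
have X0 : 0 <= X by apply: mulr_ge0 => //; apply: mulr_ge0 => //; exact: powR_ge0.
have SX : S <= X `^ (n%:R^-1).
  apply: ge_sup; first by exists (g 1), 1.
  move=> _ [u u1 ->]; have gX : g u ^+ n <= X.
    by apply: le_trans (gK u u1) _; rewrite ler_wpM2l.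
  have -> : g u = (g u ^+ n) `^ n%:R^-1 by rewrite -powR_mulrn // -powRrM divff // powRr1.
  by apply: ge0_ler_powR; rewrite ?nnegrE ?invr_ge0 ?ler0n //; exact: exprn_ge0.
have : S `^ n%:R <= X.
  have -> : X = (X `^ n%:R^-1) `^ n%:R by rewrite -powRrM mulVf // powRr1.
  by apply: ge0_ler_powR => //; exact: powR_ge0.
rewrite -{1}(subrK s n%:R) powRD ?S_neq0 ?implybT // /X mulrCA.
by rewrite ler_pM2l ?powR_gt0.
Qed.

End CircleLp.

(** * Poles with multiplicity, their reflections, and reduction to the unit circle *)

Section PolesOfRational.
Variable R : realType.
Local Open Scope classical_set_scope.
Local Notation C := R[i].
Implicit Types (f : {fraction {poly C}}) (r : R) (z u : C).

(** Passes from sums over a set of points weighted by multiplicity, as in the definitions of the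
    degree and of [mu], to sums over a list that repeats each point. *)
Lemma fsbig_count (T : choiceType) (V : nmodType) (s : seq T) (F : T -> V) (D : set T) :
  (forall a, D a <-> (0 < count_mem a s)%N) ->
  \sum_(a \in D) F a *+ count_mem a s = \sum_(a <- s) F a.
Proof.
move=> Ds; rewrite (_ : D = [set` undup s]); last first.
  by apply/seteqP; split => a; rewrite /= mem_undup -has_pred1 has_count => /Ds.
rewrite -fsbig_seq ?undup_uniq // -[RHS]big_undup_iterop_count.
exact: eq_bigr.
Qed.

Lemma rat_den_neq0 f : rat_den f != 0.
Proof.
rewrite /rat_den; have d0 : (repr f).2 != 0 := denom_ratioP _.
by rewrite divp_eq0 gcdp_eq0 (negPf d0) andbF /= -leqNgt dvdp_leq // dvdp_gcdr.
Qed.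

Definition den_roots f : seq C := sval (closed_field_poly_normal (rat_den f)).

Lemma rat_denE f : rat_den f = lead_coef (rat_den f) *: \prod_(a <- den_roots f) ('X - a%:P).
Proof. exact: svalP (closed_field_poly_normal (rat_den f)). Qed.

Lemma size_den_roots f : size (rat_den f) = (size (den_roots f)).+1.
Proof. by rewrite rat_denE size_scale ?size_prod_XsubC // lead_coef_eq0 rat_den_neq0. Qed.

Lemma mup_rat_den f z : mup z (rat_den f) = count_mem z (den_roots f).
Proof.
rewrite rat_denE -mul_polyC mupMr ?mu_prod_XsubC //.
by rewrite rootC lead_coef_eq0 rat_den_neq0.
Qed.

(** The truncated subtraction leaves no copy of [None] when infinity is not a pole, as in
    [pole_mult]. *)
Definition sphere_poles f : seq (option C) :=
  map Some (den_roots f) ++ nseq (size (rat_num f) - size (rat_den f)) None.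

Lemma pole_multE f a : pole_mult f a = count_mem a (sphere_poles f).
Proof.
rewrite /sphere_poles count_cat count_map count_nseq.
case: a => [a|] /=.
  by rewrite mul0n addn0 mup_rat_den; apply: eq_count => b.
by rewrite mul1n (eq_count (a2 := pred0)) // count_pred0.
Qed.

Lemma rat_degreeE f : rat_degree f = size (sphere_poles f).
Proof.
rewrite /rat_degree -sum1_size.
transitivity (\sum_(a \in [set a | is_pole f a]) (1%N *+ count_mem a (sphere_poles f))).
  by apply: eq_fsbigr => a _; rewrite pole_multE natn.
by apply: fsbig_count => a; rewrite /is_pole /= pole_multE.
Qed.

(** Sends a pole of R to the z_k that accounts for it; infinity goes to its reflection 0. *)
Definition reflect_pole r (x : option C) : C :=
  if x is Some a then if cmod a < r then a else (r ^+ 2)%:C / a^* else 0.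

(** Since z lies inside the circle and its reflection outside, the two conditions exclude each other
    and their truth values add up; summed over the poles this counts n_k. *)
Lemma reflect_pole_eq r z (x : option C) : 0 < r -> cmod z < r ->
  (reflect_pole r x == z) = ((x == Some z) + (x == reflect_circle r z))%N :> nat.
Proof.
move=> r0 zr; have r2 : (r ^+ 2)%:C != 0 by rewrite fmorph_eq0 expf_neq0 // gt_eqF.
have -> : reflect_circle r z = if z == 0 then None else Some ((r ^+ 2)%:C / z^*) by [].
case: x => [a|] /=; last by rewrite eq_sym; case: ifP.
have -> : (Some a == Some z) = (a == z) by [].
have [ar|ra] := ltP (cmod a) r.
  have [->|z0] := eqVneq z 0; first by rewrite addn0.
  rewrite (_ : (Some a == Some _) = false) ?addn0 //.
  apply: contraTF ar => /eqP [->]; rewrite -leNgt cmodM cmodV cmodJ cmod_real.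
  rewrite ger0_norm ?sqr_ge0 // ler_pdivlMr ?cmod_gt0 // expr2.
  by rewrite ler_wpM2l // ltW.
have a0 : a != 0 by rewrite -cmod_gt0 (lt_le_trans r0).
have -> : (a == z) = false by apply: contraTF ra => /eqP ->; rewrite -ltNge.
have [->|z0] := eqVneq z 0.
  by rewrite mulf_eq0 (negPf r2) invr_eq0 conjC_eq0 (negPf a0).
(* Reflection in the circle is an involution. *)
have refl (x y : C) : y != 0 -> x = (r ^+ 2)%:C / y^* -> y = (r ^+ 2)%:C / x^*.
  have : ((r ^+ 2)%:C)^* = (r ^+ 2)%:C :> C by exact: conjc_real.
  move: (r ^+ 2)%:C r2 => c c0 cJ y0 ->.
  by rewrite rmorphM fmorphV /= conjCK cJ invfM invrK mulrA divff // mul1r.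
rewrite add0n; congr nat_of_bool; apply/eqP/eqP => [za|[za]].
  by congr Some; apply: refl.
by apply/esym/refl.
Qed.

Definition disc_poles r f : seq C := map (reflect_pole r) (sphere_poles f).

Lemma sym_multE r f z : 0 < r -> cmod z < r ->
  sym_mult r f z = count_mem z (disc_poles r f).
Proof.
move=> r0 zr; rewrite /sym_mult !pole_multE /disc_poles count_map.
elim: (sphere_poles f) => //= x s <-.
by rewrite addnACA; congr (_ + _)%N; rewrite -reflect_pole_eq.
Qed.

Lemma cmod_den_root r f a : no_pole_in f (circle r) -> a \in den_roots f -> cmod a != r.
Proof.
move=> nf af; apply/eqP => ar; apply: (nf a ar).
by rewrite /is_pole /= mup_rat_den -has_count has_pred1.
Qed.

Lemma disc_poles_lt r f b : 0 < r -> no_pole_in f (circle r) ->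
  b \in disc_poles r f -> cmod b < r.
Proof.
move=> r0 nf /mapP[x xf ->]; case: x xf => [a|] xf; last first.
  by rewrite [reflect_pole _ _]/(0 : C) cmod0.
rewrite /reflect_pole.
have af : a \in den_roots f.
  move: xf; rewrite mem_cat mem_nseq andbF orbF => /mapP[a' a'f [->]] //.
have [//|] := ltP (cmod a) r; rewrite le_eqVlt eq_sym (negPf (cmod_den_root nf af)) /= => ra.
rewrite cmodM cmodV cmodJ cmod_real ger0_norm ?sqr_ge0 //.
by rewrite ltr_pdivrMr ?(lt_trans r0) // expr2 ltr_pM2l.
Qed.

Lemma muE r f z : 0 < r -> no_pole_in f (circle r) ->
  mu r f z = \sum_(b <- disc_poles r f) (r ^+ 2 - cmod b ^+ 2) / cmod (z - b) ^+ 2.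
Proof.
move=> r0 nf; rewrite /mu.
transitivity (\sum_(b \in [set b | cmod b < r /\ (0 < sym_mult r f b)%N])
    ((r ^+ 2 - cmod b ^+ 2) / cmod (z - b) ^+ 2) *+ count_mem b (disc_poles r f)).
  apply: eq_fsbigr => b; rewrite inE /= => -[br _].
  by rewrite sym_multE // -mulrA mulr_natl.
apply: fsbig_count => b; split => [[br]|]; first by rewrite sym_multE.
rewrite -has_count has_pred1 => bd; have br := disc_poles_lt r0 nf bd.
by split => //; rewrite sym_multE // -has_count has_pred1.
Qed.

(* The points [z_k / r], each repeated [n_k] times. *)
Definition unit_poles r f : seq C := [seq b / r%:C | b <- disc_poles r f].

Lemma size_unit_poles r f : size (unit_poles r f) = rat_degree f.
Proof. by rewrite !size_map -rat_degreeE. Qed.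

Lemma cmod_real_pos (r : R) : 0 < r -> cmod r%:C = r.
Proof. by move=> r0; rewrite cmod_real gtr0_norm. Qed.

Lemma in_disc_unit_poles r f : 0 < r -> no_pole_in f (circle r) ->
  in_disc (unit_poles r f).
Proof.
move=> r0 nf; apply/allP => _ /mapP[b bd ->].
by rewrite cmodM cmodV cmod_real_pos // ltr_pdivrMr // mul1r (disc_poles_lt r0 nf).
Qed.

Lemma mu_poisson_sum r f u : 0 < r -> no_pole_in f (circle r) ->
  mu r f (r%:C * u) = poisson_sum (unit_poles r f) u.
Proof.
move=> r0 nf; rewrite muE // /poisson_sum [RHS]big_map; apply: eq_bigr => b _.
have rC : r%:C != 0 :> C by rewrite fmorph_eq0 gt_eqF.
have -> : r%:C * u - b = r%:C * (u - b / r%:C).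
  by rewrite mulrBr mulrCA divff // mulr1.
rewrite !cmodM cmodV cmod_real_pos //.
(* Nothing is assumed on [u], so it may coincide with a point of the list; both terms are then 0 by
   the convention x / 0 = 0. *)
have [->|ub] := eqVneq (cmod (u - b / r%:C)) 0; first by rewrite mulr0 expr0n !invr0 !mulr0.
by field; rewrite ub gt_eqF.
Qed.

(** Factor by factor for |u| = 1: if |a| < r then |r u - a| = r |1 - conj b u| with b = a / r, and
    if |a| > r then r u - a = - a (1 - conj b u) with b = r / conj a. The constants r and a are
    collected in [c] and absorbed into p. *)
Lemma rat_eval_quotient r f : 0 < r -> no_pole_in f (circle r) ->
  exists2 p : {poly C}, (size p <= (size (unit_poles r f)).+1)%N &
    forall u, cmod u = 1 ->
      cmod (rat_eval f (r%:C * u)) = quotient_cmod p (unit_poles r f) u.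
Proof.
move=> r0 nf.
have rC : r%:C != 0 :> C by rewrite fmorph_eq0 gt_eqF.
pose w a : C := if cmod a < r then r%:C else a.
pose c := lead_coef (rat_den f) * \prod_(a <- den_roots f) w a.
have c0 : c != 0.
  rewrite mulf_neq0 ?lead_coef_eq0 ?rat_den_neq0 // prodf_seq_neq0.
  apply/allP => a _; apply/implyP => _; rewrite /w; have [//|ra] := ltP (cmod a) r.
  by rewrite -cmod_gt0 (lt_le_trans r0).
have den_c u : cmod u = 1 -> cmod (rat_den f).[r%:C * u] =
    cmod c * cmod (blaschke_den (unit_poles r f)).[u].
  move=> u1; rewrite horner_blaschke_den {1}rat_denE hornerZ horner_prod.
  rewrite big_map /disc_poles big_map /sphere_poles big_cat big_map /=.
(* Poles at infinity reflect to 0 and contribute factors equal to 1. *)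
rewrite [X in _ * cmod (_ * X)]big1_seq ?mulr1; last first.
    by move=> x; rewrite andTb mem_nseq => /andP[_ /eqP ->]; rewrite mul0r conjC0 mul0r subr0.
  rewrite !cmodM -mulrA; congr (_ * _); rewrite !cmod_prod -big_split /=.
  apply: eq_big_seq => a af; rewrite hornerXsubC /w.
  have [ar|] := ltP (cmod a) r.
    rewrite -cmod_blaschke_factor // -cmodM; congr cmod.
    by rewrite mulrBr mulrCA divff // mulr1.
  rewrite le_eqVlt eq_sym (negPf (cmod_den_root nf af)) /= => ra.
  rewrite -cmodM -[RHS]cmodN; congr cmod.
  have a0 : a != 0 by rewrite -cmod_gt0 (lt_trans r0).
  have cr (x : R) : (x%:C)^* = x%:C :> C by exact: conjc_real.
  rewrite !(rmorphM, fmorphV) /= conjCK !cr.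
  by field; rewrite a0 rC.
exists (c^-1 *: (rat_num f \Po (r%:C *: 'X))).
  rewrite (leq_trans (size_scale_leq _ _)) // size_comp_poly2; last first.
    by rewrite size_scale // size_polyX.
  (* The copies of [None] make up for the excess when the numerator has the larger degree. *)
  rewrite size_unit_poles rat_degreeE size_cat size_map size_nseq -addSn -size_den_roots.
  by rewrite -leq_subLR.
move=> u u1; rewrite /rat_eval /quotient_cmod !cmodM !cmodV den_c //.
by rewrite hornerZ horner_comp hornerZ hornerX [cmod (c^-1 * _)]cmodM (cmodV c) invfM mulrCA mulrA.
Qed.

Lemma circle_ptE r (t : R) : circle_pt r t = r%:C * expi t.
Proof. by apply/eqP; rewrite eq_complex /=; apply/andP; split; apply/eqP; ring. Qed.

Lemma circle_scale r z : 0 < r -> circle r z <-> exists2 u, cmod u = 1 & z = r%:C * u.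
Proof.
move=> r0; have rC : r%:C != 0 :> C by rewrite fmorph_eq0 gt_eqF.
split => [zr|[u u1 ->]]; last by rewrite /circle /= cmodM u1 mulr1 cmod_real_pos.
exists (z / r%:C); last by rewrite mulrCA divff ?mulr1.
by rewrite cmodM cmodV cmod_real_pos // zr divff // gt_eqF.
Qed.

End PolesOfRational.

(** * The two norm inequalities *)

Section NormInequalities.
Variable R : realType.
Local Open Scope classical_set_scope.
Local Notation C := R[i].
Local Notation leb := (@lebesgue_measure R).
Local Notation I2pi := (`[0, 2 * pi]%classic : set R).
Implicit Types (f : {fraction {poly C}}) (r s d : R) (u z b : C) (B : seq C).

(** Since |u - b| >= 1 - |b|, the quotient is at most (1 + |b|) / (1 - |b|), which increases with
    |b|. *)
Lemma poisson_term_le b u d : cmod u = 1 -> cmod b <= d -> d < 1 ->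
  (1 - cmod b ^+ 2) / cmod (u - b) ^+ 2 <= (1 + d) / (1 - d).
Proof.
move=> u1 bd d1; have b1 := le_lt_trans bd d1; have b0 := cmod_ge0 b.
have ub : 1 - cmod b <= cmod (u - b) by rewrite -u1 cmodB.
have cb : 0 < 1 - cmod b by rewrite subr_gt0.
have cd : 0 < 1 - d by rewrite subr_gt0.
apply: (@le_trans _ _ ((1 + cmod b) / (1 - cmod b))); last first.
  by rewrite ler_pdivrMr // mulrAC ler_pdivlMr //; nra.
rewrite ler_pdivrMr ?exprn_gt0 ?(lt_le_trans cb) //.
rewrite mulrAC ler_pdivlMr // -(subr_ge0) [X in 0 <= X](_ : _ =
  (1 + cmod b) * (cmod (u - b) ^+ 2 - (1 - cmod b) ^+ 2)); last by ring.
apply: mulr_ge0; first by rewrite addr_ge0.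
by rewrite subr_ge0 ler_sqr ?nnegrE ?cmod_ge0 // ltW.
Qed.

Lemma poisson_sum_le B u d : cmod u = 1 -> (forall b, b \in B -> cmod b <= d) -> d < 1 ->
  poisson_sum B u <= (size B)%:R * ((1 + d) / (1 - d)).
Proof.
have -> : (size B)%:R * ((1 + d) / (1 - d)) = \sum_(b <- B) ((1 + d) / (1 - d)).
  by rewrite big_const_seq count_predT iter_addr_0 mulr_natl.
rewrite /poisson_sum big_seq [leRHS]big_seq.
move=> u1 Bd d1. by apply: ler_sum => b bB; apply: poisson_term_le => //; exact: Bd.
Qed.

Lemma poisson_sum_bounded B : in_disc B ->
  exists M, forall u, cmod u = 1 -> poisson_sum B u <= M.
Proof.
move=> /allP B1; exists (\sum_(b <- B) (1 + cmod b) / (1 - cmod b)) => u u1.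
rewrite /poisson_sum big_seq [leRHS]big_seq; apply: ler_sum => b bB.
by apply: poisson_term_le => //; exact: B1.
Qed.

Lemma poisson_sum_le_mu_norm r f u : 0 < r -> no_pole_in f (circle r) -> cmod u = 1 ->
  poisson_sum (unit_poles r f) u <= circle_norm r +oo%E (mu r f).
Proof.
move=> r0 nf u1; have B1 := in_disc_unit_poles r0 nf.
rewrite -mu_poisson_sum // (le_trans (ler_norm _)) //; apply: ub_le_sup.
  (* A [sup] is known to dominate its elements only once the set is bounded. *)
  have [M BM] := poisson_sum_bounded B1; exists M => _ [z /(circle_scale _ r0)[v v1 ->] <-].
  by rewrite mu_poisson_sum // ger0_norm ?poisson_sum_ge0 ?BM.
by exists (r%:C * u) => //; apply/circle_scale => //; exists u.
Qed.

Lemma circle_nonempty r : 0 < r -> circle r !=set0.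
Proof. by move=> r0; exists (r%:C * 1); apply/circle_scale => //; exists 1 => //; exact: cmod1. Qed.

(** A pole inside the circle has modulus at most d r; one outside has modulus at least r / d, so its
    reflection has modulus at most r^2 / (r / d) = d r. *)
Lemma unit_poles_annulus r f d b : 0 < r -> 0 < d < 1 -> no_pole_in f (circle r) ->
  no_pole_in f (annulus r d) -> b \in unit_poles r f -> cmod b <= d.
Proof.
move=> r0 /andP[d0 d1] nf na /mapP[_ /mapP[x xf ->] ->].
rewrite cmodM cmodV cmod_real_pos // ler_pdivrMr //.
case: x xf => [a|] xf; last first.
  by rewrite [reflect_pole _ _]/(0 : C) cmod0 mulr_ge0 // ltW.
have pa : is_pole f (Some a) by rewrite /is_pole pole_multE -has_count has_pred1.
have := na a; rewrite /annulus /reflect_pole /= => /contra_not/(_ (fun H => H pa)).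
move=> /negP; rewrite negb_and -!leNgt.
have [ar /orP[//|ra]|ra /orP[ar|rda]] := ltP (cmod a) r.
- have : r <= d^-1 * r by rewrite ler_peMl ?(ltW r0) // invf_ge1 // ltW.
  by move=> /le_trans/(_ ra); rewrite leNgt ar.
- have : d * r < r by rewrite gtr_pMl.
  by move=> /(lt_le_trans)/(_ ra) /lt_le_trans/(_ ar); rewrite ltxx.
rewrite cmodM cmodV cmodJ cmod_real ger0_norm ?sqr_ge0 // ler_pdivrMr; last first.
  exact: lt_le_trans ra.
move: rda; rewrite ler_pdivrMl // => rda.
by rewrite expr2 mulrAC ler_wpM2r // ltW.
Qed.

Lemma mu_norm_le r f d : 0 < r -> 0 < d < 1 -> no_pole_in f (circle r) ->
  no_pole_in f (annulus r d) ->
  circle_norm r +oo%E (mu r f) <= (rat_degree f)%:R * ((1 + d) / (1 - d)).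
Proof.
move=> r0 d01 nf na; have /andP[d0 d1] := d01; apply: ge_sup.
  by have [z zr] := circle_nonempty r0; exists `|mu r f z|, z.
move=> _ [_ /(circle_scale _ r0)[u u1 ->] <-].
rewrite mu_poisson_sum // ger0_norm ?poisson_sum_ge0 ?in_disc_unit_poles //.
rewrite -(size_unit_poles r f) poisson_sum_le // => b bB.
exact: unit_poles_annulus bB.
Qed.

Lemma circle_norm_fin_ge0 r s (g : C -> R) : 0 <= circle_norm r s%:E g.
Proof. exact: powR_ge0. Qed.

Lemma rat_norm_finE r s f p B : 0 < r -> 0 < s -> in_disc B ->
  (forall u, cmod u = 1 -> cmod (rat_eval f (r%:C * u)) = quotient_cmod p B u) ->
  rat_norm r s%:E f =
    (\int[leb]_(t in I2pi) (quotient_cmod p B (expi t) `^ s) * r) `^ s^-1.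
Proof.
move=> r0 s0 B1 fE; rewrite /rat_norm /circle_norm; congr (_ `^ _).
transitivity (\int[leb]_(t in I2pi) (quotient_cmod p B (expi t) `^ s * r)).
  apply: eq_Rintegral => t _.
  by rewrite circle_ptE fE ?cmod_expi // ger0_norm ?quotient_cmod_ge0.
rewrite RintegralZr //; apply: integrable_powR_I2pi; first exact: ltW.
  exact: continuous_quotient_cmod.
by move=> t; exact: quotient_cmod_ge0.
Qed.

(** The norm integrates r dt, which compensates the r in 2 pi r; the rest is
    [quotient_cmod_powR_le]. *)
Lemma rat_eval_le r f s m (M : R) z : 0 < r -> no_pole_in f (circle r) ->
  0 < s -> s / 2 <= m%:R ->
  (forall u, cmod u = 1 -> poisson_sum (unit_poles r f) u <= M) -> circle r z ->
  cmod (rat_eval f z) <= ((m%:R * M + 1) / (2 * pi * r)) `^ s^-1 * rat_norm r s%:E f.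
Proof.
move=> r0 nf s0 sm BM /(circle_scale _ r0)[u u1 ->].
have [p sp fE] := rat_eval_quotient r0 nf; have B1 := in_disc_unit_poles r0 nf.
have M0 : 0 <= M by rewrite (le_trans _ (BM u u1)) ?poisson_sum_ge0.
rewrite (rat_norm_finE r0 s0 B1 fE) fE //.
have J0 : 0 <= \int[leb]_(t in I2pi) (quotient_cmod p (unit_poles r f) (expi t) `^ s).
  by apply: Rintegral_ge0 => t _; exact: powR_ge0.
have pr : 0 < 2 * pi * r by rewrite mulr_gt0 ?twopi_gt0.
have K0 : 0 <= (m%:R * M + 1) / (2 * pi * r).
  by apply: divr_ge0; [rewrite addr_ge0 // mulr_ge0|exact: ltW].
rewrite -powRM //; last by rewrite mulr_ge0 // ltW.
have := quotient_cmod_powR_le B1 sp s0 sm BM u1.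
set J := \int[leb]_(t in _) _ in J0 *; set g := quotient_cmod _ _ _ => gJ.
have g0 : 0 <= g by exact: quotient_cmod_ge0.
have -> : g = (g `^ s) `^ s^-1 by rewrite -powRrM divff ?powRr1 // gt_eqF.
apply: ge0_ler_powR; rewrite ?nnegrE ?invr_ge0 ?powR_ge0 ?(ltW s0) //.
  by apply: mulr_ge0 => //; rewrite mulr_ge0 // ltW.
apply: le_trans gJ _; rewrite le_eqVlt; apply/orP; left; apply/eqP.
move: (2 * pi) (twopi_gt0 R) => a a0; field.
by rewrite !gt_eqF.
Qed.

(** The pointwise bound with s = 2 and m = 1; in the sharpness argument it lets the [sup] norm
    dominate the value at r. *)
Lemma has_ubound_rat_eval r f : 0 < r -> no_pole_in f (circle r) ->
  has_ubound [set `|cmod (rat_eval f z)| | z in circle r].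
Proof.
move=> r0 nf; have [M BM] := poisson_sum_bounded (in_disc_unit_poles r0 nf).
exists (((1%:R * M + 1) / (2 * pi * r)) `^ 2^-1 * rat_norm r 2%:E f) => _ [z zr <-].
by rewrite ger0_norm ?cmod_ge0 //; apply: rat_eval_le => //; rewrite divff.
Qed.

(** K gets the exponent (t - s) / (s t) = 1 / s - 1 / t, and N^(t - s) N^s = N^t. *)
Lemma powR_interpolation (s t K N : R) : 0 < s -> 0 < t -> 0 <= K -> 0 <= N ->
  ((K `^ s^-1 * N) `^ (t - s) * N `^ s) `^ t^-1 = K `^ (s^-1 - t^-1) * N.
Proof.
move=> s0 t0 K0 N0; have tn : t != 0 by rewrite gt_eqF.
rewrite (@powRM _ _ _ (t - s)) ?powR_ge0 // -mulrA -powRD; last first.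
  by rewrite subrK (negPf tn).
rewrite subrK powRM ?powR_ge0 // -!powRrM divff // [N `^ 1]powRr1 //.
by congr (K `^ _ * N); field; rewrite tn gt_eqF.
Qed.

(** With S = K^(1 / s) N the bound for q = oo, integrating |R|^t <= S^(t - s) |R|^s gives the case q
    = t. *)
Lemma rat_norm_le r f s q m (M : R) : 0 < r -> no_pole_in f (circle r) ->
  0 < s -> (s%:E < q)%E -> s / 2 <= m%:R ->
  (forall u, cmod u = 1 -> poisson_sum (unit_poles r f) u <= M) ->
  rat_norm r q f <=
    ((m%:R * M + 1) / (2 * pi * r)) `^ exponent_gap s q * rat_norm r s%:E f.
Proof.
move=> r0 nf s0 sq sm BM; set K := (m%:R * M + 1) / _; set N := rat_norm r s%:E f.
have fle z : circle r z -> cmod (rat_eval f z) <= K `^ s^-1 * N.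
  by move=> zr; apply: rat_eval_le.
have N0 : 0 <= N by exact: circle_norm_fin_ge0.
case: q sq => [t| |]; last 2 first; [move=> _|by rewrite ltNge leNye|].
  rewrite /exponent_gap invey subr0; apply: ge_sup.
    by have [z zr] := circle_nonempty r0; exists `|cmod (rat_eval f z)|, z.
  by move=> _ [z zr <-]; rewrite ger0_norm ?cmod_ge0 ?fle.
rewrite lte_fin => st; have t0 := lt_trans s0 st.
rewrite /exponent_gap fine_invr.
have [p sp fE] := rat_eval_quotient r0 nf; have B1 := in_disc_unit_poles r0 nf.
have g0 v := quotient_cmod_ge0 p (unit_poles r f) v.
have gc := @continuous_quotient_cmod R p _ B1.
set S := K `^ s^-1 * N in fle.
have S0 : 0 <= S by rewrite mulr_ge0 ?powR_ge0.
have gS v : cmod v = 1 -> quotient_cmod p (unit_poles r f) v <= S.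
  by move=> v1; rewrite -fE // fle //; apply/circle_scale => //; exists v.
rewrite (rat_norm_finE r0 t0 B1 fE).
pose J := \int[leb]_(x in I2pi) (quotient_cmod p (unit_poles r f) (expi x) `^ s).
have J0 : 0 <= J by apply: Rintegral_ge0 => x _; exact: powR_ge0.
have NJ : J * r = N `^ s.
  rewrite /N (rat_norm_finE r0 s0 B1 fE) -/J -powRrM mulVf ?gt_eqF // powRr1 //.
  by rewrite mulr_ge0 // ltW.
have int_s : leb.-integrable I2pi
    (EFin \o (fun x => quotient_cmod p (unit_poles r f) (expi x) `^ s)).
  by apply: integrable_powR_I2pi => //; exact: ltW.
have int_t : leb.-integrable I2pi
    (EFin \o (fun x => quotient_cmod p (unit_poles r f) (expi x) `^ t)).
  by apply: integrable_powR_I2pi => //; exact: ltW.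
have Jt : \int[leb]_(x in I2pi) (quotient_cmod p (unit_poles r f) (expi x) `^ t) <=
    S `^ (t - s) * J.
  rewrite /J -RintegralZl //; apply: le_Rintegral => //.
    apply: (@eq_integrable _ _ _ leb _ _ (fun x => (S `^ (t - s))%:E *
      (quotient_cmod p (unit_poles r f) (expi x) `^ s)%:E)%E) => //.
    exact: integrableZl.
  move=> x _; have [->|gx0] := eqVneq (quotient_cmod p (unit_poles r f) (expi x)) 0.
    by rewrite !powR0 ?gt_eqF // mulr0.
  rewrite -{1}(subrK s t) powRD ?gx0 ?implybT // ler_wpM2r ?powR_ge0 //.
  by apply: ge0_ler_powR; rewrite ?nnegrE ?subr_ge0 ?(ltW st) // gS // cmod_expi.
have K0 : 0 <= K.
  have M0 : 0 <= M.
    by rewrite (le_trans _ (BM 1 (cmod1 R))) // poisson_sum_ge0.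
  by apply: divr_ge0; [rewrite addr_ge0 // mulr_ge0|rewrite mulr_ge0 ?(ltW (twopi_gt0 R)) ?ltW].
rewrite -(powR_interpolation s0 t0 K0 N0) -/S.
apply: ge0_ler_powR; rewrite ?nnegrE ?invr_ge0 ?(ltW t0) //.
- apply: mulr_ge0; last exact: ltW.
  by apply: Rintegral_ge0 => x _; exact: powR_ge0.
- by rewrite mulr_ge0 ?powR_ge0.
by rewrite -NJ mulrA ler_wpM2r // ltW.
Qed.

Lemma rat_norm_le_mu_bound r f s q m : 0 < r -> no_pole_in f (circle r) ->
  0 < s -> (s%:E < q)%E -> is_half_exponent s m ->
  rat_norm r q f <= mu_bound r s q m f.
Proof.
move=> r0 nf s0 sq /andP[sm _]; apply: rat_norm_le => // u u1.
exact: poisson_sum_le_mu_norm.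
Qed.

Lemma exponent_gap_ge0 s q : 0 < s -> (s%:E < q)%E -> 0 <= exponent_gap s q.
Proof.
move=> s0; case: q => [t| |]; last 2 first; [move=> _|by rewrite ltNge leNye|];
  rewrite /exponent_gap.
  by rewrite invey subr0 invr_ge0 ltW.
rewrite lte_fin fine_invr subr_ge0 => st; have t0 := lt_trans s0 st.
by rewrite lef_pV2 ?posrE // ltW.
Qed.

(** Monotonicity of a power with nonnegative exponent, applied to the bound of [mu] by n (1 + d) /
    (1 - d). *)
Lemma mu_bound_le_annulus_bound r f d s q m : 0 < r -> 0 < d < 1 ->
  no_pole_in f (circle r) -> no_pole_in f (annulus r d) -> 0 < s -> (s%:E < q)%E ->
  mu_bound r s q m f <= annulus_bound r d s q m (rat_degree f) f.
Proof.
move=> r0 d01 nf na s0 sq; have /andP[d0 d1] := d01.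
have mu_le := mu_norm_le r0 d01 nf na.
have mu0 : 0 <= circle_norm r +oo%E (mu r f).
  apply: le_trans (poisson_sum_le_mu_norm r0 nf (cmod1 R)).
  by rewrite poisson_sum_ge0 // in_disc_unit_poles.
have dd : 0 <= (1 + d) / (1 - d).
  by apply: divr_ge0; [rewrite addr_ge0 // ltW|rewrite subr_ge0 ltW].
have pr : 0 < 2 * pi * r by rewrite mulr_gt0 ?twopi_gt0.
have md : 0 <= m%:R * (rat_degree f)%:R * ((1 + d) / (1 - d)).
  by apply: mulr_ge0 => //; exact: mulr_ge0.
rewrite /mu_bound /annulus_bound ler_wpM2r ?circle_norm_fin_ge0 //.
rewrite -powRM; last 2 first.
- by rewrite mul1r invr_ge0 ltW.
- by rewrite addr_ge0.
apply: ge0_ler_powR; first exact: exponent_gap_ge0.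
- by rewrite nnegrE; apply: divr_ge0; [rewrite addr_ge0 // mulr_ge0|exact: ltW].
- rewrite nnegrE; apply: mulr_ge0; first by rewrite mul1r invr_ge0 ltW.
  by rewrite addr_ge0.
rewrite mulrC mul1r ler_wpM2l ?invr_ge0 ?(ltW pr) // lerD2r -mulrA.
by rewrite ler_wpM2l.
Qed.

End NormInequalities.

(** * Sharpness for the exponents oo and 2 *)

Section ExtremalFunction.
Variable R : realType.
Local Open Scope classical_set_scope.
Local Open Scope quotient_scope.
Local Notation C := R[i].
Local Notation leb := (@lebesgue_measure R).
Local Notation I2pi := (`[0, 2 * pi]%classic : set R).
Implicit Types (P Q : {poly C}) (r d : R) (n : nat).

(** Any representative of the fraction has the form (P k, Q k). Since P and Q are coprime its gcd is
    k, but only up to a unit, whence the common constant c. *)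
Lemma exists_coprime_fraction P Q : P != 0 -> Q != 0 -> coprimep P Q ->
  exists f : {fraction {poly C}}, f != 0 /\
    exists2 c : C, c != 0 & rat_num f = c *: P /\ rat_den f = c *: Q.
Proof.
move=> P0 Q0 PQ; pose x : {ratio {poly C}} := Ratio P Q.
have xn : (val x).1 = P := numer_Ratio P Q0.
have xd : (val x).2 = Q := denom_Ratio P Q0.
exists (\pi_{fraction {poly C}} x); split.
  apply/eqP; rewrite -[RHS](tofrac0 _); unlock FracField.tofrac => /eqmodP /eqP /=.
  rewrite (denom_Ratio 0 (oner_neq0 {poly C})) (numer_Ratio 0 (oner_neq0 {poly C})) xn.
  by rewrite mulr1 mulr0; apply/eqP.
have := FracField.equivf_r x; rewrite /rat_num /rat_den.
case: (repr _) => [[a b] /= b0] PbQa.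
have {}PbQa : P * b = Q * a by rewrite -xn -xd.
have : P %| a by rewrite -(Gauss_dvdpr a PQ) -PbQa dvdp_mulr.
case/dvdpP => k ak; rewrite mulrC in ak.
have bk : b = Q * k by apply: (mulfI P0); rewrite PbQa ak mulrCA.
have k0 : k != 0 by apply: contra_neq b0 => k0; rewrite bk k0 mulr0.
have /eqpf_eq [e e0 ->] : gcdp a b %= k.
  rewrite ak bk (eqp_trans (gcdp_mul2r _ _ _)) // -[X in _ %= X]mul1r eqp_mul2r //.
  by rewrite gcdp_eqp1.
exists e^-1; first by rewrite invr_eq0.
by rewrite !divpZr // ak bk !mulpK.
Qed.

(** Numerator of the reproducing kernel at the point 1 for n equal points d, built along the
    splitting of [basis_decomp]. The coefficient 1 + d is (1 - d^2) w(1), where w is the basis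
    function and w(1) = 1 / (1 - d). *)
Fixpoint extremal_num d n : {poly C} :=
  if n is k.+1 then
    (1 + d)%:C *: ('X * blaschke_num (nseq k d%:C)) +
      (1 - (d%:C)^* *: 'X) * extremal_num d k
  else 1.

(** The kernel on the diagonal at 1; it occurs both as the value of the kernel function at 1 and as
    its squared norm divided by 2 pi. *)
Definition extremal_value d n : R := n%:R * ((1 + d) / (1 - d)) + 1.

Lemma in_disc_nseq d n : 0 < d < 1 -> in_disc (nseq n (d%:C : C)).
Proof.
by move=> /andP[d0 d1]; rewrite /in_disc all_nseq cmod_real_pos // d1 orbT.
Qed.

Lemma size_extremal_num d n : (size (extremal_num d n) <= n.+1)%N.
Proof.
elim: n => [|n IH] /=; first by rewrite size_poly1.
rewrite (leq_trans (size_polyD _ _)) // geq_max; apply/andP; split.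
  by rewrite (leq_trans (size_scale_leq _ _)) // size_mulX_blaschke_num size_nseq.
rewrite (leq_trans (size_polyMleq _ _)) //.
have : (size (1 - (d%:C)^* *: 'X : {poly C})%R <= 2)%N.
  rewrite (leq_trans (size_polyD _ _)) // geq_max size_poly1 size_polyN.
  by rewrite (leq_trans (size_scale_leq _ _)) // size_polyX.
move: (size _) (size _) IH => i j ij jn.
by rewrite -subn1 leq_subLR -[(1 + n.+2)%N]/(2 + n.+1)%N leq_add.
Qed.

Lemma conj_real (x : R) : (x%:C)^* = x%:C :> C.
Proof. by exact: conjc_real. Qed.

Lemma extremal_num1 d n : 0 < d < 1 ->
  (extremal_num d n).[1] / (blaschke_den (nseq n d%:C)).[1] = (extremal_value d n)%:C.
Proof.
move=> d01; have /andP[d0 d1] := d01.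
have dC1 : 1 - d%:C != 0 :> C.
  by rewrite -(rmorph1 (real_complex R)) -rmorphB fmorph_eq0 subr_eq0 eq_sym lt_eqF.
elim: n => [|n IH].
  by rewrite /= /blaschke_den big_nil hornerC divr1 /extremal_value mul0r add0r rmorph1.
rewrite [nseq _ _]/= horner_blaschke_den_cons [extremal_num _ _]/=.
rewrite !(hornerD, hornerN, hornerZ, hornerM, hornerX, hornerC) conj_real !mulr1 !mul1r.
rewrite mulrDl -[(_ * (extremal_num d n).[1]) / _]mulf_div divff // mul1r IH.
(* For real b the factors z - b and 1 - conj b z agree at z = 1. *)
have -> : (blaschke_num (nseq n d%:C)).[1] = (blaschke_den (nseq n d%:C)).[1].
  rewrite horner_blaschke_num horner_blaschke_den; apply: eq_big_seq => b.
  by rewrite mem_nseq => /andP[_ /eqP ->]; rewrite conj_real mulr1.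
have := @blaschke_den_neq0 R (nseq n d%:C) 1 (in_disc_nseq n d01) (cmod1 R).
move: (blaschke_den _).[1] => D D0.
have -> : (1 + d)%:C * D / ((1 - d%:C) * D) = ((1 + d) / (1 - d))%:C.
  by rewrite rmorphM fmorphV rmorphB rmorph1; field; rewrite D0 dC1.
rewrite -rmorphD /extremal_value -natr1; congr (real_complex _ _); ring.
Qed.

(** By orthogonality each step adds (1 + d)^2 2 pi / (1 - d^2) = 2 pi (1 + d) / (1 - d). *)
Lemma circle_sqnorm_extremal d n : 0 < d < 1 ->
  circle_sqnorm (extremal_num d n) (nseq n d%:C) = 2 * pi * extremal_value d n.
Proof.
move=> d01; have /andP[d0 d1] := d01.
elim: n => [|n IH].
  rewrite /circle_sqnorm /blaschke_den big_nil.
  under eq_Rintegral do rewrite !hornerC divr1 cmod1 expr1n.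
  by rewrite Rintegral_I2pi_cst /extremal_value mul0r add0r.
rewrite /= circle_sqnormD ?size_nseq ?size_extremal_num //; last first.
  exact: (in_disc_nseq n.+1 d01).
rewrite IH !cmod_real_pos ?addr_gt0 // /extremal_value -natr1.
move: (2 * pi) => a; field.
by rewrite !gt_eqF ?subr_gt0 //; nra.
Qed.

(** For n > 0 the second summand vanishes at 1 / d and the first does not. This makes numerator and
    denominator coprime, so no pole is lost to cancellation. *)
Lemma extremal_num_pole d n : 0 < d < 1 -> (extremal_num d n).[d^-1%:C] != 0.
Proof.
move=> d01; have /andP[d0 d1] := d01; have dC : d%:C != 0 :> C by rewrite fmorph_eq0 gt_eqF.
case: n => [|n] /=; first by rewrite hornerC oner_neq0.
rewrite !(hornerD, hornerN, hornerZ, hornerM, hornerX, hornerC) conj_real fmorphV.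
rewrite mulfV // subrr mul0r addr0 !mulf_neq0 ?invr_eq0 //.
  by rewrite fmorph_eq0 gt_eqF // addr_gt0.
rewrite horner_blaschke_num prodf_seq_neq0; apply/allP => b.
rewrite mem_nseq => /andP[_ /eqP ->]; apply/implyP => _.
rewrite -fmorphV -rmorphB fmorph_eq0 subr_eq0 gt_eqF //.
by rewrite (lt_trans d1) // invf_gt1.
Qed.

Lemma extremal_value_gt0 d n : 0 < d < 1 -> 0 < extremal_value d n.
Proof.
move=> /andP[d0 d1]; rewrite /extremal_value ltr_wpDl // mulr_ge0 //.
by apply: divr_ge0; [rewrite addr_ge0 // ltW|rewrite subr_ge0 ltW].
Qed.

Lemma is_half_exponent2 m : is_half_exponent (2 : R) m -> m = 1%N.
Proof.
rewrite /is_half_exponent divff // (_ : 1 + 1 = 2%:R :> R) // ler1n ltr_nat.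
by case: m => [|[|m]].
Qed.

(* The extremal function is the reproducing kernel, at the point [r], of the space of
   rational functions whose only pole is [r / d], of order at most [n]. *)
Lemma exists_extremal r d n : 0 < r -> 0 < d < 1 ->
  exists f : {fraction {poly C}},
    [/\ f != 0, rat_degree f = n, no_pole_in f (circle r), no_pole_in f (annulus r d) &
        rat_norm r +oo%E f = mu_bound r 2 +oo%E 1 f /\
        rat_norm r +oo%E f = annulus_bound r d 2 +oo%E 1 n f].
Proof.
move=> r0 d01; have /andP[d0 d1] := d01.
have dC : d%:C != 0 :> C by rewrite fmorph_eq0 gt_eqF.
have rC : r%:C != 0 :> C by rewrite fmorph_eq0 gt_eqF.
(* The pole w is the reflection of d r, and e is the constant in (r u - w)^n = e (1 - d u)^n. *)
pose w : C := (r / d)%:C; pose e : C := (- w) ^+ n.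
have w0 : w != 0 by rewrite fmorph_eq0 mulf_neq0 ?invr_eq0 ?gt_eqF.
have wE : w = r%:C / d%:C by rewrite /w rmorphM fmorphV.
have e0 : e != 0 by rewrite expf_neq0 // oppr_eq0.
pose P := e *: (extremal_num d n \Po (r^-1%:C *: 'X)).
pose Q : {poly C} := ('X - w%:P) ^+ n.
have PE u : P.[r%:C * u] = e * (extremal_num d n).[u].
  by rewrite /P hornerZ horner_comp hornerZ hornerX fmorphV mulKf.
have QE u : Q.[r%:C * u] = e * (blaschke_den (nseq n d%:C)).[u].
  rewrite /Q horner_exp hornerXsubC horner_blaschke_den big_nseq iter_mulr_1 -exprMn conj_real.
  by congr (_ ^+ _); rewrite mulrBr mulr1 mulNr opprK wE; field.
have Pw : P.[w] != 0.
  by rewrite wE PE mulf_neq0 // -fmorphV extremal_num_pole.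
have P0 : P != 0 by apply: contraNneq Pw => ->; rewrite horner0.
have Q0 : Q != 0 by rewrite expf_neq0 // polyXsubC_eq0.
have cop : coprimep P Q by rewrite coprimep_expr // coprimep_XsubC.
have [f [f0 [c c0 [fN fD]]]] := exists_coprime_fraction P0 Q0 cop.
have sQ : size (rat_den f) = n.+1 by rewrite fD size_scale // size_exp_XsubC.
have sP : (size (rat_num f) <= n.+1)%N.
  rewrite fN size_scale // /P size_scale // size_comp_poly2 ?size_extremal_num //.
  by rewrite size_scale ?size_polyX // fmorph_eq0 invr_eq0 gt_eqF.
have deg : rat_degree f = n.
  rewrite rat_degreeE size_cat size_map size_nseq sQ (eqP (_ : size (rat_num f) - n.+1 == 0)%N) //.
  by rewrite addn0; have := size_den_roots f; rewrite sQ => -[].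
have pole_w z : is_pole f (Some z) -> z = w.
  rewrite /is_pole /= fD -XsubC_dvd ?scaler_eq0 ?negb_or ?c0 //.
  rewrite dvdp_XsubCl rootZ // /Q => rz; apply/eqP; move: rz.
  by rewrite /root horner_exp hornerXsubC expf_eq0 subr_eq0 => /andP[].
have cw : cmod w = r / d by rewrite cmod_real_pos // divr_gt0.
have nf : no_pole_in f (circle r).
  move=> z zr /pole_w zw; move: zr; rewrite /circle /= zw cw => /eqP.
  by rewrite gt_eqF // ltr_pdivlMr // gtr_pMr.
(* The pole lies on the boundary |z| = r / d of the open annulus. *)
have na : no_pole_in f (annulus r d).
  move=> z zr /pole_w zw; move: zr; rewrite /annulus /= zw cw.
  by rewrite (mulrC r) ltxx andbF.
have fE u : cmod u = 1 ->
    cmod (rat_eval f (r%:C * u)) = quotient_cmod (extremal_num d n) (nseq n d%:C) u.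
  move=> u1; rewrite /rat_eval /quotient_cmod fN fD (hornerZ c P) (hornerZ c Q) PE QE; congr cmod.
  by rewrite -mulf_div divff // mul1r -mulf_div divff // mul1r.
have B1 := in_disc_nseq n d01; set B := nseq n _ in fE B1.
have K0 := extremal_value_gt0 n d01; set K := extremal_value d n in K0.
have norm2 : rat_norm r 2%:E f = (2 * pi * K * r) `^ 2^-1.
  rewrite (rat_norm_finE r0 _ B1 fE) //; congr ((_ * r) `^ _).
  rewrite -circle_sqnorm_extremal //; apply: eq_Rintegral => t _.
  by rewrite (powR_mulrn 2) ?quotient_cmod_ge0.
have gap : exponent_gap (2 : R) +oo%E = 2^-1 by rewrite /exponent_gap invey subr0.
(* The bound is the square root of K / (2 pi r) times that of 2 pi K r, which is K. *)
have annE : annulus_bound r d 2 +oo%E 1 n f = K.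
  rewrite /annulus_bound gap norm2 [1%:R * n%:R]mul1r -/(extremal_value d n) -/K.
  have pr := twopi_gt0 R; move: (2 * pi) pr => a a0.
  have x1 : 0 <= 1 / (a * r) by rewrite mul1r invr_ge0 ltW // mulr_gt0.
  have x2 : 0 <= a * K * r by rewrite ltW // !mulr_gt0.
  rewrite -(powRM _ x1 (ltW K0)) -(powRM _ (mulr_ge0 x1 (ltW K0)) x2).
  have -> : 1 / (a * r) * K * (a * K * r) = K ^+ 2 by field; rewrite !gt_eqF.
  by rewrite powR12_sqrt ?sqr_ge0 // sqrtr_sqr gtr0_norm.
(* The chain K <= sup norm <= [mu_bound] <= [annulus_bound] = K forces both equalities for one and
   the same function. *)
have ann_ge : mu_bound r 2 +oo%E 1 f <= K.
  by rewrite -annE -deg; apply: mu_bound_le_annulus_bound => //; rewrite ltry.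
have mu_ge : rat_norm r +oo%E f <= mu_bound r 2 +oo%E 1 f.
  apply: rat_norm_le_mu_bound => //; first by rewrite ltry.
  by rewrite /is_half_exponent divff // lexx ltrDl ltr01.
have K_le : K <= rat_norm r +oo%E f.
  apply: ub_le_sup; first exact: has_ubound_rat_eval.
  exists (r%:C * 1); first by apply/circle_scale => //; exists 1 => //; exact: cmod1.
  rewrite fE ?cmod1 // /quotient_cmod extremal_num1 // cmod_real_pos //.
  by rewrite gtr0_norm.
exists f; split => //; rewrite annE; split; apply/le_anti.
  by rewrite mu_ge (le_trans ann_ge).
by rewrite K_le (le_trans mu_ge).
Qed.

End ExtremalFunction.

Theorem theorem3p2 (R : realType) (r : R) (r_gt0 : 0 < r) :
  (forall (n : nat) (f : {fraction {poly R[i]}}),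
     rat_degree f = n -> no_pole_in f (circle r) ->
     forall (p : R) (q : \bar R) (m : nat),
       0 < p -> (p%:E < q)%E -> is_half_exponent p m ->
       rat_norm r q f <= mu_bound r p q m f /\
       (forall d : R, 0 < d < 1 -> no_pole_in f (annulus r d) ->
          rat_norm r q f <= annulus_bound r d p q m n f))
  /\
  (forall n : nat, exists f : {fraction {poly R[i]}},
     [/\ f != 0, rat_degree f = n, no_pole_in f (circle r) &
         forall m : nat, is_half_exponent (2 : R) m ->
           rat_norm r +oo%E f = mu_bound r 2 +oo%E m f])
  /\
  (forall (n : nat) (d : R), 0 < d < 1 ->
     exists f : {fraction {poly R[i]}},
       [/\ f != 0, rat_degree f = n, no_pole_in f (circle r),
           no_pole_in f (annulus r d) &
           forall m : nat, is_half_exponent (2 : R) m ->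
             rat_norm r +oo%E f = annulus_bound r d 2 +oo%E m n f]).
Proof.
split=> [n f degf nf p q m p0 pq pm|].
  split=> [|d d01 na]; first exact: rat_norm_le_mu_bound.
  apply: le_trans (rat_norm_le_mu_bound r_gt0 nf p0 pq pm) _.
  by rewrite -degf; exact: mu_bound_le_annulus_bound.
split=> [n|n d d01].
  (* Any d strictly between 0 and 1 serves, since equality with [mu_bound] holds for each of
     them. *)
  pose d : R := 2^-1.
  have d01 : 0 < d < 1 by rewrite /d; apply/andP; split; lra.
  have [f [f0 degf nf _ [fE _]]] := exists_extremal n r_gt0 d01.
  by exists f; split => // m /is_half_exponent2 ->.
have [f [f0 degf nf na [_ fE]]] := exists_extremal n r_gt0 d01.
by exists f; split => // m /is_half_exponent2 ->.
Qed.
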